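(* Let $\varphi,\alpha$ satisfy Assumption A, as spelled out in the context, and let $X,Y$ be Banach spaces such that $X\hookrightarrow Y$ compactly and $Y\hookrightarrow V=L^\varphi(\Omega)$ continuously. Let $L$ be a bounded subset of $L^\infty(0,T;X)$ and assume that the set $L_t:=\{f_t:f\in L\}$ of time derivatives is bounded in $\mathcal V=L^\varphi(Q)$. Then $L$ is relatively compact in $C^0([0,T];Y)$.
   Context: Let $\Omega\subset\mathbb R^N$ be an open set of finite measure, $T>0$, $Q:=\Omega\times(0,T)$. Assumption A. $\varphi:\Omega\times\mathbb R\to[0,+\infty)$ and $\alpha:\Omega\times\mathbb R\to\mathbb R$ are such that for a.e. $x\in\Omega$ and every $r\in\mathbb R$ the subdifferential $\partial\varphi(x,r):=\{\xi\in\mathbb R:\varphi(x,r')-\varphi(x,r)\ge\xi(r'-r)\ \forall r'\in\mathbb R\}$ is single-valued and equals $\alpha(x,r)$. Let $\varphi^*(x,r):=\sup_{s\in\mathbb R}\{rs-\varphi(x,s)\}$. It is assumed that: (a) for a.e. $x\in\Omega$, $\varphi(x,\cdot)$ is strictly convex, lower semicontinuous and even, and $\partial\varphi(x,0)=0$; (b) (i) for all $r\in\mathbb R$, $\varphi(\cdot,r)$ is measurable in $\Omega$; (ii) $\varphi(\cdot,1),\varphi^*(\cdot,1)\in L^1(\Omega)$; (c) there is a constant $K\ge2$ such that $\varphi(x,2r)\le K\varphi(x,r)$ and $\varphi^*(x,2r)\le K\varphi^*(x,r)$ for all $r\ge0$ and a.e. $x\in\Omega$. Spaces. For measurable $v:\Omega\to\mathbb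 R$ put $\varrho_{\varphi,\Omega}(v):=\int_\Omega\varphi(x,|v(x)|)\,dx$. The Musielak-Orlicz space $V=L^\varphi(\Omega)$ is the set of measurable $v$ with $\varrho_{\varphi,\Omega}(\lambda v)<+\infty$ for some $\lambda>0$, with norm $\|v\|_V:=\inf\{\lambda>0:\varrho_{\varphi,\Omega}(v/\lambda)\le1\}$. Likewise $\mathcal V=L^\varphi(Q)$ is defined, with its Luxemburg norm, from $\varrho_{\varphi,Q}(v):=\iint_Q\varphi(x,|v(x,t)|)\,dx\,dt$. Elements of $\mathcal V$ are regarded also as elements of $L^1(0,T;V)$ via $v(t):=v(\cdot,t)$ (continuous embedding), so elements of $L$ are identified with their continuous representatives with values in $V$. *)

(* Defs.v *)
From HB Require Import structures.
From mathcomp Require Import all_boot all_order all_algebra.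
From mathcomp Require Import all_classical all_reals all_analysis ess_sup_inf.
Import Order.TTheory GRing.Theory Num.Theory.
Import numFieldNormedType.Exports.

Set Implicit Arguments.
Unset Strict Implicit.
Unset Printing Implicit Defensive.

Local Open Scope classical_set_scope.
Local Open Scope ring_scope.

(* The sigma-algebra generated by the coordinates is the Borel one. *)
Section measurable_rV.
Context {R : realType} {n : nat}.

Let coors : 'I_n -> 'rV[R]_n -> R := fun i x => x ord0 i.

Let rV_set0 : g_sigma_preimage coors set0.
Proof. exact: sigma_algebra0. Qed.

Let rV_setC A : g_sigma_preimage coors A -> g_sigma_preimage coors (~` A).
Proof. exact: sigma_algebraC. Qed.

Let rV_bigcup (F : (set 'rV[R]_n)^nat) :
  (forall i, g_sigma_preimage coors (F i)) ->
  g_sigma_preimage coors (\bigcup_i (F i)).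
Proof. exact: sigma_algebra_bigcup. Qed.

HB.instance Definition _ := @isMeasurable.Build default_measure_display
  'rV[R]_n (g_sigma_preimage coors) rV_set0 rV_setC rV_bigcup.

Lemma measurable_coord (i : 'I_n) :
  measurable_fun [set: 'rV[R]_n] (fun x : 'rV[R]_n => x ord0 i).
Proof.
move=> _ Y mY; rewrite setTI; apply: sub_sigma_algebra => /=.
rewrite -bigcup_seq/=; exists i => /=; first by rewrite mem_index_enum.
by exists Y => //; rewrite setTI.
Qed.

Lemma measurable_fun_rVP d (T : measurableType d) (f : T -> 'rV[R]_n) :
  (forall i, measurable_fun [set: T] (fun x => f x ord0 i)) ->
  measurable_fun [set: T] f.
Proof.
move=> mf _ A; rewrite setTI => mA.
suff H : g_sigma_preimage coors `<=` [set B | measurable (f @^-1` B)].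
  exact: H.
apply: smallest_sub.
  split => /=.
  - by rewrite preimage_set0.
  - by move=> B mB; rewrite setTD preimage_setC; exact: measurableC.
  - by move=> F mF; rewrite preimage_bigcup; exact: bigcup_measurable.
rewrite -bigcup_seq => B [i _] [C mC <-] /=; rewrite setTI.
by have := mf i measurableT C mC; rewrite setTI.
Qed.

End measurable_rV.

Section lebesgue_measure_rV.
Context {R : realType}.
Local Open Scope ereal_scope.

Definition rV_cons n (p : measurableTypeR R * 'rV[R]_n) : 'rV[R]_n.+1 :=
  \row_j (if unlift ord0 j is Some k then p.2 ord0 k else p.1).

Definition rV_uncons n (x : 'rV[R]_n.+1) : measurableTypeR R * 'rV[R]_n :=
  (x ord0 ord0, \row_j x ord0 (lift ord0 j)).

Lemma rV_consK n : cancel (@rV_cons n) (@rV_uncons n).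
Proof.
case=> a x; rewrite /rV_uncons/= mxE unlift_none; congr pair.
by apply/rowP => j; rewrite !mxE liftK.
Qed.

Lemma measurable_rV_cons n : measurable_fun setT (@rV_cons n).
Proof.
apply: measurable_fun_rVP => i.
under eq_fun do rewrite mxE.
case: unliftP => [k _|_] /=; last exact: measurable_fst.
by apply: (measurableT_comp (measurable_coord k)); exact: measurable_snd.
Qed.

Lemma measurable_rV_uncons n : measurable_fun setT (@rV_uncons n).
Proof.
apply/measurable_fun_pairP; split; first exact: measurable_coord.
apply: measurable_fun_rVP => i /=.
under eq_fun do rewrite mxE.
exact: measurable_coord.
Qed.

Section step.
Variables (n : nat) (m : {sigma_finite_measure set 'rV[R]_n -> \bar R}).

Definition lebesgue_rV_step : set 'rV[R]_n.+1 -> \bar R :=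
  pushforward (@lebesgue_measure R \x m) (@rV_cons n).

HB.instance Definition _ := Measure.copy lebesgue_rV_step
  (measure_function_pushforward__canonical__measure_function_Measure
    (@lebesgue_measure R \x m) (@measurable_rV_cons n)).

Lemma lebesgue_rV_step_sigma_finite : sigma_finite setT lebesgue_rV_step.
Proof.
have /sigma_finiteP[F [FT ndF Foo]] := sigma_finiteT (@lebesgue_measure R).
have /sigma_finiteP[G [GT ndG Goo]] := sigma_finiteT m.
exists (fun k => @rV_uncons n @^-1` (F k `*` G k)).
  apply/seteqP; split => // x _.
  have [a _ Fa] : (\bigcup_k F k) (rV_uncons x).1 by rewrite -FT.
  have [b _ Gb] : (\bigcup_k G k) (rV_uncons x).2 by rewrite -GT.
  exists (maxn a b) => //; split.
    by move: Fa; exact/subsetPset/ndF/leq_maxl.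
  by move: Gb; exact/subsetPset/ndG/leq_maxr.
move=> k; have [mF Fk] := Foo k; have [mG Gk] := Goo k.
have mFG : measurable (F k `*` G k) by exact: measurableX.
split.
  rewrite -[X in measurable X]setTI.
  exact: (@measurable_rV_uncons n measurableT _ mFG).
rewrite /lebesgue_rV_step /pushforward -comp_preimage.
rewrite (_ : _ \o _ = id); last by apply/funext => x /=; rewrite rV_consK.
by rewrite preimage_id product_measure1E// lte_mul_pinfty// ge0_fin_numE.
Qed.

HB.instance Definition _ := Measure_isSigmaFinite.Build _ _ _
  lebesgue_rV_step lebesgue_rV_step_sigma_finite.

End step.

Fixpoint lebesgue_rV (n : nat) : {sigma_finite_measure set 'rV[R]_n -> \bar R} :=
  match n with
  | 0 => dirac (0%R : 'rV[R]_0)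
  | k.+1%N => lebesgue_rV_step (lebesgue_rV k)
  end.

End lebesgue_measure_rV.

(* For mu the Lebesgue measure on Borel sets, these are measurability and
   integrability with respect to its completion: a function is measurable for
   the completion iff it is a.e. equal to a measurable one. *)
Definition ae_measurable_fun d (T : measurableType d) (R : realType)
    (mu : {measure set T -> \bar R}) (D : set T) d' (U : measurableType d')
    (f : T -> U) :=
  exists2 g : T -> U, measurable_fun D g & f = g %[ae mu in D].

Definition ae_integrable d (T : measurableType d) (R : realType)
    (mu : {measure set T -> \bar R}) (D : set T) (f : T -> \bar R) :=
  exists2 g : T -> \bar R, mu.-integrable D g & f = g %[ae mu in D].

Section convexity.
Context {R : realType}.

Definition subdifferential (f : R -> R) (r : R) : set R :=
  [set xi | forall r', xi * (r' - r) <= f r' - f r].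

Definition convex_conjugate (f : R -> R) (r : R) : \bar R :=
  ereal_sup [set (r * s - f s)%:E | s in [set: R]].

Definition strictly_convex (f : R -> R) :=
  forall a b t, a != b -> 0 < t < 1 ->
    f (t * a + (1 - t) * b) < t * f a + (1 - t) * f b.

End convexity.

Section assumptionA.
Context {R : realType} {N : nat}.
Variables (Omega : set 'rV[R]_N) (phi alpha : 'rV[R]_N -> R -> R).
Let mu := @lebesgue_rV R N.

Record assumptionA : Prop := AssumptionA {
  A_ge0 : forall x r, Omega x -> 0 <= phi x r ;
  A_subdiff : {ae mu, forall x, Omega x ->
    forall r, subdifferential (phi x) r = [set alpha x r]} ;
  A_convex : {ae mu, forall x, Omega x -> strictly_convex (phi x)} ;
  A_lsc : {ae mu, forall x, Omega x ->
    lower_semicontinuous (EFin \o phi x)} ;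
  A_even : {ae mu, forall x, Omega x -> forall r, phi x (- r) = phi x r} ;
  A_subdiff0 : {ae mu, forall x, Omega x ->
    subdifferential (phi x) 0 = [set 0]} ;
  A_measurable : forall r, ae_measurable_fun mu Omega (phi ^~ r) ;
  A_int : ae_integrable mu Omega (fun x => (phi x 1)%:E) ;
  A_int_conj : ae_integrable mu Omega (fun x => convex_conjugate (phi x) 1) ;
  A_Delta2 : exists2 K : R, 2 <= K &
    {ae mu, forall x, Omega x -> forall r, 0 <= r ->
      phi x (2 * r) <= K * phi x r /\
      (convex_conjugate (phi x) (2 * r)%R <=
        K%:E * convex_conjugate (phi x) r)%E}
}.

End assumptionA.

(* Lphi consists of functions, not of classes modulo a.e. equality on D;
   accordingly luxemburg is a seminorm on Lphi. It is extended-valued: the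
   infimum of the empty set is +oo. *)
Section musielak_orlicz.
Context d (T : measurableType d) {R : realType}.
Variables (mu : {measure set T -> \bar R}) (D : set T) (Phi : T -> R -> R).
Local Open Scope ereal_scope.

Definition modular (v : T -> R) : \bar R :=
  \int[mu]_(z in D) (Phi z `|v z|)%:E.

Definition Lphi : set (T -> R) :=
  [set v | ae_measurable_fun mu D v /\
    exists2 lambda : R, (0 < lambda)%R &
      modular (fun z => lambda * v z)%R < +oo].

Definition luxemburg (v : T -> R) : \bar R :=
  ereal_inf [set lambda%:E | lambda in
    [set lambda : R | (0 < lambda)%R /\ modular (fun z => v z / lambda)%R <= 1]].

End musielak_orlicz.

(* Bochner measurability and integral over D (a set of reals of finite
   measure) for functions with values in the seminormed space (V, p), V being a
   subspace of E. The seminorm may be infinite outside V, which is harmless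
   since all the simple functions are V-valued. The integral is a relation
   because it is determined only up to p-null vectors. *)
Section bochner.
Context {R : realType} {E : lmodType R}.
Variables (V : set E) (p : E -> \bar R) (D : set R).
Let mu := @lebesgue_measure R.

(* [:: (A_1, e_1); ...; (A_k, e_k)] encodes the simple function
   \sum_i \1_(A_i) *: e_i *)
Definition simple_wf (s : seq (set R * E)) :=
  forall a, a \in s -> measurable a.1 /\ V a.2.

Definition simple_val (s : seq (set R * E)) (t : R) : E :=
  \sum_(a <- s) (\1_(a.1) t : R) *: a.2.

Definition simple_integral (s : seq (set R * E)) : E :=
  \sum_(a <- s) fine (mu (a.1 `&` D)) *: a.2.

Definition simple_approx (f : R -> E) (s : nat -> seq (set R * E)) :=
  (forall n, simple_wf (s n)) /\
  {ae mu, forall t, D t ->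
    (fun n => p (f t - simple_val (s n) t)) @ \oo --> 0%E}.

Definition strongly_measurable (f : R -> E) := exists s, simple_approx f s.

Definition is_bochner_integral (f : R -> E) (I : E) :=
  V I /\ exists s, [/\ simple_approx f s,
    (fun n => \int[mu]_(t in D) p (f t - simple_val (s n) t))%E @ \oo --> 0%E &
    (fun n => p (I - simple_integral (s n))) @ \oo --> 0%E].

End bochner.

Section evolution_spaces.
Context {R : realType}.
Variable T : R.

Definition Linfty_norm {X : normedModType R} (f : R -> X) : \bar R :=
  ess_sup (@lebesgue_measure R)
    ((fun t => (`|f t|)%:E) \_ (`]0, T[ : set R)).

Definition Linfty {X : normedModType R} : set (R -> X) :=
  [set f | strongly_measurable setT (fun x : X => `|x|%:E) `]0, T[ f /\
           (Linfty_norm f < +oo)%E].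

Definition test_function (psi : R -> R) :=
  [/\ forall n t, derivable (derive1n n psi) t 1,
      compact (closure [set t | psi t != 0]) &
      closure [set t | psi t != 0] `<=` `]0, T[].

(* The derivative is that of V-valued distributions on (0,T):
   \int_0^T psi'(t) f(t) dt = - \int_0^T psi(t) g(t) dt in V. *)
Definition is_time_derivative {E : lmodType R} (V : set E) (p : E -> \bar R)
    (f g : R -> E) :=
  forall psi, test_function psi ->
    exists I, is_bochner_integral V p `]0, T[ (fun t => derive1 psi t *: f t) I /\
              is_bochner_integral V p `]0, T[ (fun t => psi t *: g t) (- I).

End evolution_spaces.

Section C0.
Context {R : realType}.

Definition C0 (T : R) (Y : normedModType R) : Type :=
  initial_topology (fun g : continuousType (`[0, T]%classic : set R) Y =>
    (g : {uniform (`[0, T]%classic : set R) -> Y})).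

HB.instance Definition _ T Y := Uniform.on (@C0 T Y).

(* the a.e. class of i \o f on (0,T) is that of the continuous function g *)
Definition C0_representative (T : R) (X Y : normedModType R) (i : X -> Y)
    (f : R -> X) (g : C0 T Y) :=
  {ae @lebesgue_measure R, forall t, forall u : (`[0, T]%classic : set R),
     \val u = t -> (g : continuousType _ _) u = i (f t)}.

End C0.

Section embeddings.
Context {R : realType}.

Definition compact_embedding (X Y : normedModType R) (i : {linear X -> Y}) :=
  [/\ injective i, continuous i &
      forall B : set X, bounded_set B -> precompact (i @` B)].

(* j picks a representative of the image of each y, so that linearity and
   injectivity hold modulo a.e. equality. *)
Definition embedding_in_Lphi d (T : measurableType d)
    (mu : {measure set T -> \bar R}) (D : set T) (Phi : T -> R -> R)
    (Y : normedModType R) (j : Y -> T -> R) :=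
  [/\ forall y, Lphi mu D Phi (j y),
      forall a y z, j (a *: y + z) = a *: j y + j z %[ae mu in D],
      forall y, j y = cst 0 %[ae mu in D] -> y = 0 &
      exists C : R, forall y, (luxemburg mu D Phi (j y) <= (C * `|y|)%:E)%E].

End embeddings.

(* Main.v *)
From mathcomp Require Import all_boot all_order all_algebra.
From mathcomp Require Import all_classical all_reals all_analysis.
From mathcomp Require Import ess_sup_inf measurable_realfun ring lra.
Require Import Defs.
Import Order.TTheory GRing.Theory Num.Theory.
Import numFieldNormedType.Exports.
Set Implicit Arguments.
Unset Strict Implicit.
Unset Printing Implicit Defensive.
Local Open Scope classical_set_scope.
Local Open Scope ring_scope.

(* Write p for the Luxemburg norm of V and rho for the modular. The Delta_2
   condition on phi^* amounts to phi(x, 2r/K) <= phi(x, r)/K, whence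
     p w <= l (K/2)^n + l 2^-n rho(w/l)   for all n and all l > 0.
   Let v be the derivative of f, with norm less than l. Testing it against
   smooth approximations of the indicator of [s, t], where s < t are Lebesgue
   points of f, and integrating the above bound of p(v(.)) gives
     p(f t - f s) <= l (K/2)^n (t - s) + l 2^-n.
   Off a null set, f is therefore continuous for p with a modulus that does not
   depend on f in L. Since f is bounded in X, compactly embedded in Y, Ehrling's
   inequality turns p into the norm of Y: f extends continuously to [0, T] and
   the Arzela-Ascoli theorem applies. *)

(** * Convex functions with conjugate in Delta_2 *)

(** A bound on the derivative in L^1(0,T;V) alone would not give equicontinuity: ever steeper
    approximations of a jump satisfy it. What excludes them is that n is free: the modular enters
    with the factor l 2^-n, made small by n alone, and only then is t - s chosen against the factor
    l (K/2)^n. Measurability shapes the rest. phi(x, r) is measurable in x for fixed r only, and up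
    to null sets; the function t -> p (F t - s_n t), for s_n simple, is not known to be measurable.
    Integrals are therefore compared as lower integrals, and a measurable majorant is supplied
    wherever additivity is used. For the same reason Lebesgue points are those of f in X, where f is
    strongly measurable for a norm; the embeddings then bound p of the increments by the increments
    of f in X. The elements of V are functions and not classes, so p is a seminorm; that it vanishes
    only on functions null a.e. is used once, to give Ehrling's inequality its hypothesis. *)

Record young {R : realType} (K : R) (f : R -> R) : Prop := Young {
  young_ge0 : forall r, 0 <= f r ;
  young0 : f 0 = 0 ;
  young_convex : forall a b t, 0 <= t <= 1 ->
    f (t * a + (1 - t) * b) <= t * f a + (1 - t) * f b ;
  young_subgradient : forall r, exists xi, forall r', xi * (r' - r) <= f r' - f r ;
  young_nabla2 : forall u, 0 <= u -> f (2 / K * u) <= f u / K ;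
  young_gt0 : forall r, 0 < r -> 0 < f r }.

Section young_theory.
Context {R : realType}.
Variables (K : R) (f : R -> R).
Hypotheses (K2 : 2 <= K) (yf : young K f).

Lemma young_le_scale t b : 0 <= t <= 1 -> f (t * b) <= t * f b.
Proof.
move=> t01; have := young_convex yf b 0 t01.
by rewrite (young0 yf) !mulr0 !addr0.
Qed.

Lemma young_nd a b : 0 <= a -> a <= b -> f a <= f b.
Proof.
move=> a0; rewrite le_eqVlt => /predU1P[->//|ab].
have b0 : 0 < b by exact: le_lt_trans ab.
have t01 : 0 <= a / b <= 1 by rewrite divr_ge0 ?(ltW b0)//= ler_pdivrMr// mul1r ltW.
have := young_le_scale b t01; rewrite divfK ?gt_eqF// => /le_trans; apply.
by rewrite ler_piMl ?(young_ge0 yf)//; case/andP: t01.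
Qed.

Lemma young_nabla2X n u : 0 <= u -> f ((2 / K) ^+ n * u) <= f u / K ^+ n.
Proof.
have K0 : 0 < K by apply: lt_le_trans K2.
elim: n u => [|n IH] u u0; first by rewrite !expr0 mul1r divr1.
rewrite exprSr -mulrA (le_trans (IH _ _))//; first by rewrite mulr_ge0// divr_ge0// ltW.
rewrite exprS invfM mulrA ler_wpM2r ?invr_ge0 ?exprn_ge0 ?(ltW K0)//.
exact: (young_nabla2 yf).
Qed.

(** A subgradient xi at u gives f u - f q <= |xi| (u - q), so every rational slightly to the left of
    u works. The bound u / 2 on the distance keeps q nonnegative. *)
Lemma young_rat_sup u e : 0 <= u -> 0 < e ->
  exists q : rat, [/\ 0 <= ratr q :> R, ratr q <= u & f u - e < f (ratr q)].
Proof.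
rewrite le_eqVlt => /predU1P[<- e0|u0 e0].
  by exists 0%Q; rewrite rmorph0 lexx; split=> //; lra.
have [xi hxi] := young_subgradient yf u.
pose d := Num.min (u / 2) (e / (`|xi| + 1)).
have d0 : 0 < d.
  by rewrite lt_min divr_gt0//= divr_gt0// ltr_wpDl.
have [q] : exists q : rat, ratr q \in `]u - d, u[.
  by apply: rat_in_itvoo; rewrite ltrBlDr ltrDl.
rewrite in_itv/= => /andP[dq qu]; exists q; split; last 2 first.
- exact: ltW.
- have := hxi (ratr q); have : - (xi * (ratr q - u)) < e; last by lra.
  have ud : u - ratr q < d by lra.
  have -> : - (xi * (ratr q - u)) = xi * (u - ratr q) by ring.
  rewrite (@le_lt_trans _ _ (`|xi| * (u - ratr q)))//.
    by rewrite ler_wpM2r ?ler_norm// subr_ge0 ltW.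
  rewrite (@le_lt_trans _ _ ((`|xi| + 1) * (u - ratr q)))//.
    by rewrite ler_wpM2r ?lerDl// subr_ge0 ltW.
  rewrite mulrC -ltr_pdivlMr ?ltr_wpDl// (lt_le_trans ud)//.
  by rewrite /d ge_min lexx orbT.
- have : d <= u / 2 by rewrite /d ge_min lexx.
  by lra.
Qed.

End young_theory.

(** Extracts what is used of Assumption A at almost every fixed x. The Delta_2 condition on the
    conjugate is carried over to phi itself by equality in Young's inequality at the points alpha x
    s. *)
Lemma assumptionA_young {R : realType} {N : nat} (Omega : set 'rV[R]_N)
    (phi alpha : 'rV[R]_N -> R -> R) : assumptionA Omega phi alpha ->
  exists2 K : R, 2 <= K &
    {ae lebesgue_rV N, forall x, Omega x -> young K (phi x)}.
Proof.
case=> phi0 sub cvx _ even sub0 _ _ _ [K K2 d2]; exists K => //.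
have [K0 Kn0] : 0 < K /\ K != 0 by split; lra.
apply: (@filter_app2 _ _ _ _ _ _ _ even sub0).
apply: (@filter_app2 _ _ _ _ _ _ _ sub cvx).
move: d2; apply: filterS => x d2 subx cvxx evenx subx0 Ox.
move: {d2 subx cvxx evenx subx0} (d2 Ox) (subx Ox) (cvxx Ox) (evenx Ox) (subx0 Ox).
move=> d2x subx cvxx evenx subx0.
have subP r r' : alpha x r * (r' - r) <= phi x r' - phi x r.
  by have : subdifferential (phi x) r (alpha x r) by rewrite subx.
have alpha0 : alpha x 0 = 0.
  have : [set 0] (alpha x 0) by rewrite -subx0 subx.
  by [].
have phi_min r : phi x 0 <= phi x r.
  by have := subP 0 r; rewrite alpha0 mul0r subr_ge0.
have conjE r : convex_conjugate (phi x) (alpha x r) = (r * alpha x r - phi x r)%:E.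
  apply/eqP; rewrite eq_le; apply/andP; split.
    apply: ge_ereal_sup => _ [s _ <-]; rewrite lee_fin.
    have := subP r s; rewrite mulrBr => h.
    rewrite [r * _]mulrC; lra.
  by apply: ereal_sup_ubound; exists r => //; rewrite mulrC.
(* Delta_2 compares the conjugate at 2 alpha(s) and at alpha(s). Bounding the former from below by
   its competitor u gives 2 alpha(s) u - phi(u) <= K (s alpha(s) - phi(s)), and s = 2u/K is the
   choice for which the terms in alpha(s) cancel. *)
have nabla u : 0 <= u -> phi x (2 / K * u) <= phi x u / K.
  move=> u0; set s := 2 / K * u.
  have s0 : 0 <= s by rewrite mulr_ge0// divr_ge0// ltW.
  have r0 : 0 <= alpha x s.
    move: s0; rewrite le_eqVlt => /predU1P[<-|s0]; first by rewrite alpha0.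
    have := subP s 0; rewrite sub0r mulrN => h.
    have := phi_min s => h'.
    have : 0 <= alpha x s * s by lra.
    by rewrite pmulr_lge0.
  have [_] := d2x _ r0; rewrite conjE => h.
  have : ((2 * alpha x s * u - phi x u)%:E <= K%:E * (s * alpha x s - phi x s)%:E)%E.
    apply: le_trans h; apply: ereal_sup_ubound; exists u => //.
  rewrite -EFinM lee_fin ler_pdivlMr// mulrBr {1}/s.
  have -> : K * (2 / K * u * alpha x s) = 2 * alpha x s * u by field.
  by move=> h'; rewrite [_ * K]mulrC; lra.
(* The normalization at 0 comes from the inequality just proved at u = 0, namely phi(x,0) <=
   phi(x,0)/K with K >= 2. *)
have p0 : phi x 0 = 0.
  have := nabla 0 (lexx _); rewrite mulr0 ler_pdivlMr// => h.
  have := phi0 x 0 Ox; rewrite le_eqVlt => /predU1P[//|h0].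
  have : 0 < phi x 0 * (K - 1) by rewrite mulr_gt0//; lra.
  by rewrite mulrBr mulr1; lra.
split => //.
- by move=> r; exact: phi0.
- move=> a b t; have [<- _|ab] := eqVneq a b.
    by rewrite -!mulrDl subrKC !mul1r.
  rewrite le_eqVlt => /andP[/predU1P[<- _|t0]].
    by rewrite !mul0r !add0r subr0 !mul1r.
  rewrite le_eqVlt => /predU1P[->|t1].
    by rewrite subrr !mul0r !addr0 !mul1r.
  by apply: ltW; apply: cvxx; rewrite ?t0.
- by move=> r; exists (alpha x r).
(* 0 is the midpoint of r and -r, where phi takes equal values; strict convexity makes these exceed
   phi(x,0) = 0. *)
- move=> r r0; have rNr : r != - r by apply/eqP => h; lra.
  have h : 0 < (1 / 2 : R) < 1 by lra.
  have := cvxx _ _ _ rNr h; rewrite evenx.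
  have -> : 1 / 2 * r + (1 - 1 / 2) * - r = 0 by field.
  rewrite p0; lra.
Qed.

(** * Lower integrals *)

(* The library's integral of a nonnegative function is the lower integral,
   whence the absence of measurability hypotheses below. *)
Section lower_integral.
Context d (T : measurableType d) (R : realType).
Variable mu : {measure set T -> \bar R}.
Local Open Scope ereal_scope.
Import HBNNSimple.

(** A simple function below f, multiplied by the indicator of the complement of the exceptional null
    set, keeps its integral and lies below g everywhere. *)
Lemma ae_le_lower_integral (D : set T) (f g : T -> \bar R) :
  (forall x, D x -> 0 <= f x) -> (forall x, D x -> 0 <= g x) ->
  {ae mu, forall x, D x -> f x <= g x} ->
  \int[mu]_(x in D) f x <= \int[mu]_(x in D) g x.
Proof.
move=> f0 g0 [N [mN muN fgN]].
rewrite [leLHS]ge0_integralE// [leRHS]ge0_integralE//.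
apply: ge_ereal_sup => _ [h hf <-].
have mNC : measurable (~` N) by exact: measurableC.
have -> : sintegral mu h = sintegral mu (proj_nnsfun h mNC).
  have E (k : {nnsfun T >-> R}) : sintegral mu k = \int[mu]_x (k x)%:E.
    by rewrite integral_nnsfun// patch_setT.
  rewrite !E [LHS](ge0_negligible_integral _ _ _ _ muN)//; last 2 first.
    - exact/measurable_EFinP.
    - by move=> x _; rewrite lee_fin.
  rewrite [RHS](ge0_negligible_integral _ _ _ _ muN)//; last 2 first.
    - exact/measurable_EFinP.
    - by move=> x _; rewrite lee_fin.
  apply: eq_integral => x; rewrite inE => -[_ Nx] /=.
  by rewrite mindicE mem_set// mulr1.
apply: ereal_sup_ubound; exists (proj_nnsfun h mNC) => //= x.
rewrite mindicE; case: (boolP (x \in ~` N)) => [/set_mem Nx|Nx].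
  rewrite mulr1; apply: (le_trans (hf x)); rewrite !patchE.
  case: ifPn => // /set_mem Dx; apply: contrapT => fgx.
  by apply/Nx/fgN => /(_ Dx).
by rewrite mulr0 erestrict_ge0.
Qed.

(** Lower integrals are not subadditive in general; measurability of g alone restores this. If h is
    simple and h <= f + g, then max(h - g, 0) is measurable and at most f, and h <= max(h - g, 0) +
    g is a bound between measurable functions. *)
Lemma lower_integralD (D : set T) (f g : T -> \bar R) : measurable D ->
  (forall x, D x -> 0 <= f x) -> (forall x, D x -> 0 <= g x) ->
  measurable_fun D g ->
  \int[mu]_(x in D) (f x + g x) <= \int[mu]_(x in D) f x + \int[mu]_(x in D) g x.
Proof.
move=> mD f0 g0 mg.
rewrite [leLHS]ge0_integralE; last by move=> x Dx; rewrite adde_ge0 ?f0 ?g0.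
apply: ge_ereal_sup => _ [h hfg <-].
have -> : sintegral mu h = \int[mu]_(x in D) (h x)%:E.
  rewrite integral_nnsfun//; suff -> : (h \_ D) = h by []. apply/funext => x.
  rewrite patchE; case: ifPn => // Dx; have := hfg x.
  rewrite patchE (negbTE Dx) lee_fin => h0.
  by apply/le_anti/andP; split; [exact: fun_ge0|exact: h0].
have mh : measurable_fun D (EFin \o h).
  by apply: measurable_funTS; exact/measurable_EFinP.
pose k x := maxe ((h x)%:E - g x) 0.
have mk : measurable_fun D k.
  by apply: measurable_maxe => //; exact: emeasurable_funB.
have k0 x : 0 <= k x by rewrite /k le_max lexx orbT.
apply: (@le_trans _ _ (\int[mu]_(x in D) (k x + g x))).
  apply: ge0_le_integral => //.
  - by move=> x _; rewrite lee_fin.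
  - exact: emeasurable_funD.
  - move=> x Dx; rewrite /k; have := g0 x Dx; case: (g x) => [r r0| |//].
      by rewrite -leeBlDr// le_max lexx.
    by move=> _; rewrite max_r ?leNye// add0e leey.
rewrite ge0_integralD// leeD2r// ae_le_lower_integral//.
apply/aeW => x Dx; rewrite /k ge_max f0// andbT.
have := hfg x; rewrite patchE mem_set//; have := g0 x Dx.
case: (g x) => [r r0| |//].
  by rewrite leeBlDr.
by move=> _ _; rewrite addeNy leNye.
Qed.

End lower_integral.

(** * Musielak-Orlicz spaces *)

Section ae_measurable.
Context d (T : measurableType d) (R : realType).
Variables (mu : {measure set T -> \bar R}) (D : set T).

Lemma ae_measurable_comp d1 (U1 : measurableType d1) d2 (U2 : measurableType d2)
    (h : U1 -> U2) (f : T -> U1) : measurable_fun setT h ->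
  ae_measurable_fun mu D f -> ae_measurable_fun mu D (h \o f).
Proof.
move=> mh [g mg fg]; exists (h \o g); first exact: measurableT_comp.
by move: fg; apply: filterS => x /[apply] /= ->.
Qed.

Lemma ae_measurableZ (c : R) (f : T -> R) :
  ae_measurable_fun mu D f -> ae_measurable_fun mu D (fun x => c * f x).
Proof. by apply: (@ae_measurable_comp _ _ _ _ ( *%R c)); exact: mulrl_measurable. Qed.

Lemma ae_measurableD (f g : T -> R) :
  ae_measurable_fun mu D f -> ae_measurable_fun mu D g ->
  ae_measurable_fun mu D (f \+ g).
Proof.
move=> [f' mf ff'] [g' mg gg']; exists (f' \+ g'); first exact: measurable_funD.
by apply: filterS2 ff' gg' => x hf hg Dx; rewrite /= hf// hg.
Qed.

Lemma ae_measurable_eq d1 (U1 : measurableType d1) (f g : T -> U1) :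
  f = g %[ae mu in D] -> ae_measurable_fun mu D g -> ae_measurable_fun mu D f.
Proof. by move=> fg [h mh gh]; exists h => //; exact: ae_eq_trans fg gh. Qed.

End ae_measurable.

(** Stated over an arbitrary measure space so that one theory serves both on Omega and on Omega x
    (0,T). *)
Record musielak d (T : measurableType d) (R : realType)
    (mu : {measure set T -> \bar R}) (D : set T) (K : R) (Phi : T -> R -> R) :
    Prop := Musielak {
  musielak_measurable_set : measurable D ;
  musielak_K : 2 <= K ;
  musielak_ge0 : forall z r, D z -> 0 <= Phi z r ;
  musielak_measurable : forall r, ae_measurable_fun mu D (Phi ^~ r) ;
  musielak_young : {ae mu, forall z, D z -> young K (Phi z)} }.

(** The interface for Bochner integration: p may be infinite outside V, and nothing is asked about
    its null vectors. *)
Record sublinear (R : realType) (E : lmodType R) (V : set E) (p : E -> \bar R) :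
    Prop := Sublinear {
  subl0 : V 0 ;
  sublD : forall u v, V u -> V v -> V (u + v) ;
  sublZ : forall c u, V u -> V (c *: u) ;
  subl_ge0 : forall u, (0 <= p u)%E ;
  subl_fin : forall u, V u -> (p u < +oo)%E ;
  subl_leD : forall u v, V u -> V v -> (p (u + v)%R <= p u + p v)%E ;
  subl_leZ : forall c u, V u -> (p (c *: u)%R <= `|c|%:E * p u)%E }.

Section modular_theory.
Context d (T : measurableType d) (R : realType).
Variables (mu : {measure set T -> \bar R}) (D : set T) (K : R) (Phi : T -> R -> R).
Hypothesis mPhi : musielak mu D K Phi.
Let mD := musielak_measurable_set mPhi.
Let K2 := musielak_K mPhi.
Local Notation ameas := (@ae_measurable_fun _ _ _ mu D _ _).
Local Notation rho := (modular mu D Phi).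
Local Notation V := (Lphi mu D Phi).
Local Notation p := (luxemburg mu D Phi).

(* Phi z r is measurable in z for fixed r only, so Phi z |w z| is written as the
   supremum of Phi z q over the rationals q in [0, |w z|]. *)
Lemma musielak_comp_measurable (w : T -> R) : ameas w ->
  exists H : T -> \bar R, [/\ measurable_fun setT H, forall z, (0 <= H z)%E &
    {ae mu, forall z, D z -> (Phi z `|w z|)%:E = H z}].
Proof.
move=> [g mg wg].
have /choice[h hP] : forall q : rat, exists h : T -> R,
    measurable_fun D h /\ Phi ^~ (ratr q) = h %[ae mu in D].
  by move=> q; have [h mh hP] := musielak_measurable mPhi (ratr q); exists h.
(* The rationals are enumerated by [unpickle]. The default value 0 does not affect a supremum of
   nonnegative terms, and the maximum with 0 keeps F nonnegative on the null set where [h q] differs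
   from Phi. *)
pose F n (z : T) : \bar R := if unpickle n is Some q then
  (if (0 <= ratr q :> R) && (ratr q <= `|(g \_ D) z|)
   then (Num.max ((h q \_ D) z) 0)%:E else 0%E) else 0%E.
have F0 n z : (0 <= F n z)%E.
  rewrite /F; case: unpickle => [q|]//; case: ifP => // _.
  by rewrite lee_fin le_max lexx orbT.
exists (fun z => esups (F ^~ z) 0%N); split.
- apply: measurable_fun_esups => n; rewrite /F; case: unpickle => [q|]; last exact: measurable_cst.
  apply: measurable_fun_ifT => //.
    apply: measurable_and; first exact: measurable_cst.
    apply: measurable_fun_ler; first exact: measurable_cst.
    by apply: measurableT_comp => //; exact: (measurable_restrictT g mD).1.
  apply/measurable_EFinP; apply: measurable_maxr; last exact: measurable_cst.
  exact: (measurable_restrictT (h q) mD).1 (hP q).1.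
- by move=> z; apply: le_trans (F0 0%N z) _; apply: ereal_sup_ubound; exists 0%N.
have : {ae mu, forall z, forall n, D z -> forall q, unpickle n = Some q ->
    Phi z (ratr q) = h q z}.
  apply: ae_foralln => n; case E : (unpickle n) => [q|]; last by apply/aeW.
  by have := (hP q).2; apply: filterS => z + Dz _ [<-]; exact.
apply: filter_app; apply: filterS2 wg (musielak_young mPhi) => z wg Y hz Dz.
have {}hz q : Phi z (ratr q) = h q z by apply: (hz (pickle q)) => //; rewrite pickleK.
have {}Y := Y Dz; have {}wg := wg Dz.
have FE n : F n z = if unpickle n is Some q then
  (if (0 <= ratr q :> R) && (ratr q <= `|w z|) then (Phi z (ratr q))%:E else 0%E) else 0%E.
  rewrite /F; case: unpickle => // q; rewrite !patchE mem_set// -wg -hz.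
  by rewrite max_l// (young_ge0 Y).
apply/eqP; rewrite eq_le; apply/andP; split.
- apply/lee_addgt0Pr => e e0.
  have [q [q0 qw wq]] := young_rat_sup Y (normr_ge0 (w z)) e0.
  rewrite -leeBlDr//; apply: (@le_trans _ _ (F (pickle q) z)).
    by rewrite FE pickleK q0 qw/= -EFinB lee_fin ltW.
  by apply: ereal_sup_ubound; exists (pickle q).
- apply: ge_ereal_sup => _ [n _ <-]; rewrite FE; case: unpickle => [q|]; last first.
    by rewrite lee_fin (young_ge0 Y).
  case: ifP => [/andP[q0 qw]|_]; last by rewrite lee_fin (young_ge0 Y).
  by rewrite lee_fin (young_nd Y).
Qed.

Lemma modular_ge0 w : (0 <= rho w)%E.
Proof. by apply: integral_ge0 => z Dz; rewrite lee_fin (musielak_ge0 mPhi). Qed.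

Lemma le_modular (v w : T -> R) :
  {ae mu, forall z, D z -> `|v z| <= `|w z|} -> (rho v <= rho w)%E.
Proof.
move=> vw; apply: ae_le_lower_integral.
- by move=> z Dz; rewrite lee_fin (musielak_ge0 mPhi).
- by move=> z Dz; rewrite lee_fin (musielak_ge0 mPhi).
apply: filterS2 vw (musielak_young mPhi) => z vw Y Dz.
by rewrite lee_fin (young_nd (Y Dz))// vw.
Qed.

Lemma eq_modular (v w : T -> R) : v = w %[ae mu in D] -> rho v = rho w.
Proof.
move=> vw; apply/eqP; rewrite eq_le; apply/andP; split; apply: le_modular;
  by move: vw; apply: filterS => z /[apply] ->.
Qed.

Lemma modular_measurableE w (H : T -> \bar R) : (forall z, (0 <= H z)%E) ->
  {ae mu, forall z, D z -> (Phi z `|w z|)%:E = H z} ->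
  rho w = (\int[mu]_(z in D) H z)%E.
Proof.
move=> H0 HP; apply/eqP; rewrite eq_le; apply/andP.
split; apply: ae_le_lower_integral => //.
- by move=> z Dz; rewrite lee_fin (musielak_ge0 mPhi).
- by apply: filterS HP => z /[apply] ->.
- by move=> z Dz; rewrite lee_fin (musielak_ge0 mPhi).
- by apply: filterS HP => z /[apply] ->.
Qed.

Lemma modular_convex (u v : T -> R) s : ameas u -> ameas v -> 0 <= s <= 1 ->
  (rho (fun z => s * u z + (1 - s) * v z)%R <=
   s%:E * rho u + (1 - s)%:E * rho v)%E.
Proof.
move=> mu1 mv /[dup] s01 /andP[s0 s1].
have s10 : 0 <= 1 - s by rewrite subr_ge0.
have [H [mH H0 HP]] := musielak_comp_measurable mu1.
have [G [mG G0 GP]] := musielak_comp_measurable mv.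
rewrite (modular_measurableE H0 HP) (modular_measurableE G0 GP).
have mHD : measurable_fun D H by exact: measurable_funTS.
have mGD : measurable_fun D G by exact: measurable_funTS.
rewrite -!ge0_integralZl ?lee_fin//.
rewrite -ge0_integralD//; last 4 first.
- by move=> z _; rewrite mule_ge0// lee_fin.
- exact: measurable_funeM.
- by move=> z _; rewrite mule_ge0// lee_fin.
- exact: measurable_funeM.
apply: ae_le_lower_integral.
- by move=> z Dz; rewrite lee_fin (musielak_ge0 mPhi).
- by move=> z Dz; rewrite adde_ge0// mule_ge0// lee_fin.
move: HP GP; apply: filterS3 (musielak_young mPhi) => z Y HP GP Dz.
rewrite -HP// -GP// -!EFinM -EFinD lee_fin; have {}Y := Y Dz.
apply: le_trans (young_convex Y _ _ s01); apply: (young_nd Y) => //.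
by rewrite (le_trans (ler_normD _ _))// !normrM (ger0_norm s0) (ger0_norm s10).
Qed.

Lemma modular0 : rho (fun=> 0) = 0%E.
Proof.
rewrite (@modular_measurableE _ (cst 0%E))//; first by rewrite integral0.
apply: filterS (musielak_young mPhi) => z Y Dz.
by rewrite normr0 (young0 (Y Dz)).
Qed.

Lemma ameas_cst (c : R) : ameas (fun=> c).
Proof. by exists (fun=> c) => //; exact: ae_eq_refl. Qed.

Lemma modular_le_scale (u : T -> R) s : ameas u -> 0 <= s <= 1 ->
  (rho (fun z => s * u z)%R <= s%:E * rho u)%E.
Proof.
move=> mu1 s01; have := modular_convex mu1 (ameas_cst 0) s01.
rewrite modular0 mule0 adde0; apply: le_trans; apply: le_modular.
by apply/aeW => z _; rewrite mulr0 addr0.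
Qed.

Lemma Lphi_ameas w : V w -> ameas w. Proof. by case. Qed.

Lemma Lphi0 : V 0.
Proof.
split; first exact: (ameas_cst 0).
exists 1 => //; rewrite (_ : rho _ = 0%E) ?ltry// -modular0.
by apply: eq_modular; apply/aeW => z _; rewrite mulr0.
Qed.

Lemma LphiZ c w : V w -> V (c *: w).
Proof.
move=> [mw [l l0 lw]]; split; first exact: ae_measurableZ.
exists (l / (`|c| + 1)); first by rewrite divr_gt0// ltr_wpDl.
apply: le_lt_trans lw; apply: le_modular; apply/aeW => z _.
have -> : (c *: w) z = c * w z by [].
rewrite !normrM [`|_^-1|]ger0_norm ?invr_ge0 ?addr_ge0//.
rewrite -mulrA ler_wpM2l// mulrA ler_piMl//.
by rewrite mulrC ler_pdivrMr ?mul1r ?lerDl// ltr_wpDl.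
Qed.

Lemma LphiD u v : V u -> V v -> V (u + v).
Proof.
move=> [mu1 [l l0 lu]] [mv [k k0 kv]]; split; first exact: ae_measurableD.
pose m := Num.min l k; have m0 : 0 < m by rewrite lt_min l0.
have ml : m <= l by rewrite ge_min lexx.
have mk : m <= k by rewrite ge_min lexx orbT.
exists (m / 2); first by rewrite divr_gt0.
have h2 : 0 <= (1 / 2 : R) <= 1 by lra.
have := modular_convex (ae_measurableZ m mu1) (ae_measurableZ m mv) h2.
rewrite (_ : rho _ = rho (fun z => m / 2 * (u + v) z)%R); last first.
  by apply: eq_modular; apply/aeW => z _; rewrite -[(u + v) z]/(u z + v z); field.
move=> /le_lt_trans; apply; rewrite lte_add_pinfty//.
  apply: lte_mul_pinfty; [by rewrite lee_fin; lra|by []|].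
  apply: le_lt_trans lu; apply: le_modular; apply/aeW => z _.
  by rewrite !normrM ler_wpM2r// !gtr0_norm.
apply: lte_mul_pinfty; [by rewrite lee_fin; lra|by []|].
apply: le_lt_trans kv; apply: le_modular; apply/aeW => z _.
by rewrite !normrM ler_wpM2r// !gtr0_norm.
Qed.

Lemma luxemburg_ge0 w : (0 <= p w)%E.
Proof. by apply: le_ereal_inf_tmp => _ [l [l0 _] <-]; rewrite lee_fin ltW. Qed.

Lemma luxemburg_le w l : 0 < l -> (rho (fun z => w z / l)%R <= 1)%E ->
  (p w <= l%:E)%E.
Proof. by move=> l0 lw; apply: ereal_inf_lbound; exists l. Qed.

Lemma luxemburg_lt w r : ameas w -> (p w < r%:E)%E ->
  0 < r /\ (rho (fun z => w z / r)%R <= 1)%E.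
Proof.
move=> mw /ereal_inf_lt[_ [l [l0 lw] <-]]; rewrite lte_fin => lr.
have r0 : 0 < r by exact: lt_trans lr.
split=> //; apply: le_trans lw; apply: le_modular; apply/aeW => z _.
rewrite !normrM ler_wpM2l// !gtr0_norm ?invr_gt0//.
by rewrite lef_pV2 ?posrE// ltW.
Qed.

Lemma eq_luxemburg v w : v = w %[ae mu in D] -> p v = p w.
Proof.
move=> vw; congr ereal_inf; apply/seteqP.
suff h (a b : T -> R) : a = b %[ae mu in D] -> forall x : \bar R,
    (exists2 l : R, 0 < l /\ (rho (fun z => a z / l)%R <= 1)%E & l%:E = x) ->
    exists2 l : R, 0 < l /\ (rho (fun z => b z / l)%R <= 1)%E & l%:E = x.
  by split => x /h; apply => //; exact: ae_eq_sym.
move=> ab x [l [l0 la] <-]; exists l => //; split => //.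
rewrite -(@eq_modular (fun z => a z / l))//.
by move: ab; apply: filterS => z /[apply] ->.
Qed.

(* Iterating the nabla_2 condition n times gains a factor 2^-n over homogeneity. *)
Lemma luxemburg_le_modular w l n : ameas w -> 0 < l ->
  (p w <= (l * (2 / K) ^- n)%:E +
          (l / 2 ^+ n)%:E * rho (fun z => w z / l)%R)%E.
Proof.
move=> mw l0; have K0 : 0 < K by exact: lt_le_trans K2.
have a0 : 0 < (2 / K) ^+ n by rewrite exprn_gt0// divr_gt0.
have l2 : 0 < l / 2 ^+ n by rewrite divr_gt0// exprn_gt0.
have := modular_ge0 (fun z => w z / l)%R.
case E : (rho _) => [r| |//] r0; last by rewrite gt0_muley ?lte_fin// addey// leey.
(* Multiplying w / l by (2/K)^n brings its modular r down to at most r / K^n. As th >= 1 and r / K^n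
   <= th, dividing further by th brings it below 1, by convexity. *)
rewrite lee_fin in r0; pose th := 1 + r / K ^+ n.
have th0 : 0 < th by rewrite ltr_pwDl// divr_ge0// exprn_ge0// ltW.
rewrite -EFinM -EFinD.
have -> : l * (2 / K) ^- n + l / 2 ^+ n * r = th * (2 / K) ^- n * l.
  by rewrite /th expr_div_n; field; rewrite !expf_neq0//= gt_eqF.
apply: luxemburg_le; first by rewrite !mulr_gt0// invr_gt0.
pose w1 z := (2 / K) ^+ n * (w z / l).
have mw1 : ameas (fun z => w z / l).
  by have := ae_measurableZ (l^-1) mw; apply: ae_measurable_eq; apply/aeW => z _; rewrite mulrC.
have h1 : (rho w1 <= (r / K ^+ n)%:E)%E.
  have [H [mH H0 HP]] := musielak_comp_measurable mw1.
  rewrite mulrC EFinM -E (modular_measurableE H0 HP) -ge0_integralZl//; last 2 first.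
    exact: measurable_funTS.
    by rewrite lee_fin invr_ge0 exprn_ge0// ltW.
  apply: ae_le_lower_integral.
  - by move=> z Dz; rewrite lee_fin (musielak_ge0 mPhi).
  - by move=> z Dz; rewrite mule_ge0// lee_fin invr_ge0 exprn_ge0// ltW.
  apply: filterS2 HP (musielak_young mPhi) => z HP Y Dz.
  rewrite -HP// -EFinM lee_fin /w1 normrM [`|_ ^+ n|]gtr0_norm// [leRHS]mulrC.
  exact: (young_nabla2X _ (Y Dz)).
have th01 : 0 <= th^-1 <= 1.
  by rewrite invr_ge0 ltW//= invf_le1// lerDl divr_ge0// exprn_ge0// ltW.
have := modular_le_scale (ae_measurableZ _ mw1 : ameas w1) th01.
rewrite (_ : rho _ = rho (fun z => w z / (th * (2 / K) ^- n * l))%R); last first.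
  apply: eq_modular; apply/aeW => z _; rewrite /w1 !invfM invrK.
  by ring.
move=> /le_trans; apply.
apply: (@le_trans _ _ ((th^-1)%:E * (r / K ^+ n)%:E)%E).
  by rewrite lee_wpmul2l// lee_fin invr_ge0 ltW.
by rewrite -EFinM lee_fin mulrC ler_pdivrMr// mul1r /th lerDr.
Qed.

(** The case n = 0 of [luxemburg_le_modular], that is p w <= l + l rho(w / l). *)
Lemma luxemburg_fin w : V w -> (p w < +oo)%E.
Proof.
move=> [mw [l l0 lw]]; have := @luxemburg_le_modular w l^-1 0%N mw.
rewrite invr_gt0 => /(_ l0) /le_lt_trans; apply.
rewrite lte_add_pinfty ?ltry// lte_mul_pinfty//; first by rewrite lee_fin divr_ge0// invr_ge0 ltW.
apply: le_lt_trans lw; apply: le_modular; apply/aeW => z _.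
by rewrite invrK mulrC.
Qed.

Lemma luxemburg_triangle (u v : T -> R) : ameas u -> ameas v -> (p (u \+ v)%R <= p u + p v)%E.
Proof.
move=> mu1 mv; have pu0 := luxemburg_ge0 u; have pv0 := luxemburg_ge0 v.
have [pu|] := ltP (p u) +oo%E; last first.
  by rewrite leye_eq => /eqP ->; rewrite addye ?leey// gt_eqF// (lt_le_trans _ pv0).
have [pv|] := ltP (p v) +oo%E; last first.
  by rewrite leye_eq => /eqP ->; rewrite addey ?leey// gt_eqF// (lt_le_trans _ pu0).
apply/lee_addgt0Pr => e e0.
have pufin : p u \is a fin_num by rewrite ge0_fin_numE.
have pvfin : p v \is a fin_num by rewrite ge0_fin_numE.
pose a := fine (p u) + e / 2; pose b := fine (p v) + e / 2.
have [a0 ua] : 0 < a /\ (rho (fun z => u z / a)%R <= 1)%E.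
  by apply: luxemburg_lt => //; rewrite -(fineK pufin) lte_fin ltrDl divr_gt0.
have [b0 vb] : 0 < b /\ (rho (fun z => v z / b)%R <= 1)%E.
  by apply: luxemburg_lt => //; rewrite -(fineK pvfin) lte_fin ltrDl divr_gt0.
have -> : (p u + p v + e%:E)%E = (a + b)%:E.
  by rewrite -(fineK pufin) -(fineK pvfin) -!EFinD /a /b; congr EFin; field.
clearbody a b; have ab0 : 0 < a + b by rewrite addr_gt0.
apply: luxemburg_le => //.
have mua : ameas (fun z => u z / a).
  by have := ae_measurableZ a^-1 mu1; apply: ae_measurable_eq; apply/aeW => z _; rewrite mulrC.
have mvb : ameas (fun z => v z / b).
  by have := ae_measurableZ b^-1 mv; apply: ae_measurable_eq; apply/aeW => z _; rewrite mulrC.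
have s01 : 0 <= a / (a + b) <= 1.
  by rewrite divr_ge0 ?(ltW a0) ?(ltW ab0)//= ler_pdivrMr// mul1r lerDl ltW.
have sE : 1 - a / (a + b) = b / (a + b) by field; rewrite gt_eqF.
have := modular_convex mua mvb s01; rewrite sE.
rewrite (_ : rho _ = rho (fun z => (u \+ v) z / (a + b))%R); last first.
  by apply: eq_modular; apply/aeW => z _; rewrite /=; field; rewrite !gt_eqF.
move=> /le_trans; apply.
apply: (@le_trans _ _ ((a / (a + b))%:E * 1 + (b / (a + b))%:E * 1)%E).
  by rewrite leeD// lee_wpmul2l// lee_fin divr_ge0// ltW.
by rewrite !mule1 -EFinD lee_fin -mulrDl divff// gt_eqF.
Qed.

Lemma luxemburgZ c (w : T -> R) : ameas w -> (p w < +oo)%E -> (p (c *: w)%R <= `|c|%:E * p w)%E.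
Proof.
move=> mw pw; have pw0 := luxemburg_ge0 w.
have pwfin : p w \is a fin_num by rewrite ge0_fin_numE.
apply/lee_addgt0Pr => e e0.
pose a := fine (p w) + e / (`|c| + 1).
have c1 : 0 < `|c| + 1 by rewrite ltr_wpDl.
have [a0 wa] : 0 < a /\ (rho (fun z => w z / a)%R <= 1)%E.
  by apply: luxemburg_lt => //; rewrite -(fineK pwfin) lte_fin ltrDl divr_gt0.
have ca : `|c| * a <= `|c| * fine (p w) + e.
  rewrite mulrDr lerD2l mulrCA ler_piMr ?(ltW e0)//.
  by rewrite ler_pdivrMr// mul1r lerDl.
rewrite -(fineK pwfin) -EFinM -EFinD; apply/lee_addgt0Pr => k k0.
have l0 : 0 < `|c| * fine (p w) + e + k.
  by rewrite addr_gt0// ltr_wpDl// mulr_ge0// fine_ge0.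
clearbody a; rewrite -EFinD; apply: luxemburg_le => //.
apply: le_trans wa; apply: le_modular; apply/aeW => z _.
have -> : (c *: w) z = c * w z by [].
rewrite !normrM -mulrA mulrCA ler_wpM2l// [`|_^-1|]gtr0_norm ?invr_gt0//.
rewrite [`|a^-1|]gtr0_norm ?invr_gt0// ler_pdivrMr// mulrC ler_pdivlMr//.
by rewrite (le_trans ca)// lerDl ltW.
Qed.

(** If p w = 0 then rho(w / l) <= 1 for every l > 0, so rho w <= l rho(w / l) <= l for l <= 1 by
    convexity. Hence rho w = 0, and Phi is positive away from 0. *)
Lemma luxemburg_eq0 (w : T -> R) : ameas w -> p w = 0%E -> w = cst 0 %[ae mu in D].
Proof.
move=> mw pw.
have wl l : 0 < l -> (rho (fun z => w z / l)%R <= 1)%E.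
  by move=> l0; have [] // := @luxemburg_lt w l mw; rewrite pw lte_fin.
have rw : rho w = 0%E.
  apply/eqP; rewrite eq_le modular_ge0 andbT; apply/lee_addgt0Pr => e e0.
  rewrite add0e; pose l := Num.min e 1.
  have l0 : 0 < l by rewrite lt_min e0/=.
  have l1 : l <= 1 by rewrite ge_min lexx orbT.
  apply: (@le_trans _ _ l%:E); last by rewrite lee_fin ge_min lexx.
  have mwl : ameas (fun z => w z / l).
    by have := ae_measurableZ l^-1 mw; apply: ae_measurable_eq; apply/aeW => z _; rewrite mulrC.
  have l01 : 0 <= l <= 1 by rewrite ltW.
  have := modular_le_scale mwl l01; rewrite (_ : rho _ = rho w); last first.
    by apply: eq_modular; apply/aeW => z _; rewrite mulrC divfK// gt_eqF.
  move=> /le_trans; apply; rewrite -[leRHS]mule1 lee_wpmul2l ?wl//.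
  by rewrite lee_fin ltW.
have [H [mH H0 HP]] := musielak_comp_measurable mw.
rewrite (modular_measurableE H0 HP) in rw.
have : ae_eq mu D H (cst 0%E).
  apply/(ae_eq_integral_abs mu mD); first exact: measurable_funTS.
  by rewrite -[RHS]rw; apply: eq_integral => z _; rewrite gee0_abs.
move: HP; apply: filterS3 (musielak_young mPhi) => z Y HP Hz Dz.
have := HP Dz; rewrite (Hz Dz) => /= -[] Pz.
have [//|wz] := eqVneq (w z) 0.
by have := young_gt0 (Y Dz); move=> /(_ `|w z|); rewrite Pz ltxx normr_gt0 => /(_ wz).
Qed.

Lemma luxemburg_sublinear : sublinear (E := T -> R) V p.
Proof.
split.
- exact: Lphi0.
- exact: LphiD.
- exact: LphiZ.
- exact: luxemburg_ge0.
- exact: luxemburg_fin.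
- by move=> u v /Lphi_ameas mu1 /Lphi_ameas mv; exact: luxemburg_triangle.
- by move=> c u Vu; apply: luxemburgZ; [exact: Lphi_ameas|exact: luxemburg_fin].
Qed.

End modular_theory.

(** * Measurability of open subsets of R^N *)

Section open_rV_measurable.
Context {R : realType} {N : nat}.

Lemma rV_ball_measurable (x : 'rV[R]_N) (e : R) : measurable (ball x e).
Proof.
have [e0|e0] := ltP 0 e; last first.
  rewrite (_ : ball x e = set0); first exact: measurable0.
  by apply/seteqP; split => // y []; rewrite ltNge e0.
rewrite (_ : ball x e = \big[setI/setT]_(j : 'I_N)
    ((fun y : 'rV[R]_N => y ord0 j) @^-1` (ball (x ord0 j) e))).
  apply: bigsetI_measurable => j _; rewrite -[X in measurable X]setTI.
  exact: (measurable_coord j measurableT (measurable_ball (x ord0 j) e)).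
rewrite -bigcap_seq; apply/seteqP; split=> [y [_ xy] j _|y xy]; first exact: xy.
by split=> // k j; rewrite (ord1 k); apply: xy; rewrite /= mem_index_enum.
Qed.

(** The sigma-algebra is generated by the coordinates, so O is written as a countable union of balls
    with rational centres and radii 1/(n+1). A radius below e / 2 leaves room to move the centre
    from x to a rational point. *)
Lemma open_rV_measurable (O : set 'rV[R]_N) : open O -> measurable O.
Proof.
move=> oO.
pose F k : set 'rV[R]_N := if (unpickle k : option ('rV[rat]_N * nat)) is Some (q, n) then
  (if `[< ball (map_mx ratr q : 'rV[R]_N) n.+1%:R^-1 `<=` O >]
   then ball (map_mx ratr q : 'rV[R]_N) n.+1%:R^-1 else set0) else set0.
rewrite (_ : O = \bigcup_k F k).
  apply: bigcup_measurable => k _; rewrite /F.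
  case: unpickle => [[q n]|]; last exact: measurable0.
  by case: ifP => _; [exact: rV_ball_measurable|exact: measurable0].
apply/seteqP; split=> [x Ox|x [k _]]; last first.
  by rewrite /F; case: unpickle => [[q n]|]//; case: asboolP => // + /[dup] _; exact.
have /nbhs_ballP[e /= e0 eO] : nbhs x O by exact: open_nbhs_nbhs.
have [n ne] : exists n, n.+1%:R^-1 < e / 2 :> R.
  have := near_infty_natSinv_lt (PosNum (divr_gt0 e0 (ltr0n R 2))).
  by move=> [n _ /(_ n (leqnn n))] /= ?; exists n.
have n0 : 0 < n.+1%:R^-1 :> R by rewrite invr_gt0 ltr0n.
have /choice[q qP] : forall j : 'I_N, exists q : rat, `|x ord0 j - ratr q| < n.+1%:R^-1.
  move=> j; have [q] : exists q : rat, ratr q \in `]x ord0 j - n.+1%:R^-1, x ord0 j + n.+1%:R^-1[.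
    by apply: rat_in_itvoo; rewrite ltrBlDr -addrA ltrDl addr_gt0.
  by rewrite in_itv/= => xq; exists q; rewrite ltr_distlC.
pose qv : 'rV[rat]_N := \row_j q j.
have bq : ball (map_mx ratr qv : 'rV[R]_N) n.+1%:R^-1 x.
  by split => // i j; rewrite !mxE (ord1 i) /ball/= distrC.
exists (pickle (qv, n)) => //; rewrite /F pickleK ifT//; apply/asboolP.
move=> y qy; apply: eO; have := ball_triangle (ball_sym bq) qy.
by apply: le_ball; rewrite (splitr e) lerD// ltW.
Qed.

Lemma assumptionA_musielak (Omega : set 'rV[R]_N) (phi alpha : 'rV[R]_N -> R -> R) :
  open Omega -> assumptionA Omega phi alpha ->
  exists K, musielak (lebesgue_rV N) Omega K phi.
Proof.
move=> oO A; have [K K2 Y] := assumptionA_young A; exists K; split => //.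
- exact: open_rV_measurable.
- by move=> z r Oz; exact: (A_ge0 A).
- exact: (A_measurable A).
Qed.

End open_rV_measurable.

(** * Bochner integrals *)

Lemma ge0_ecvg0P (R : realType) (u : nat -> \bar R) : (forall n, (0 <= u n)%E) ->
  (u @ \oo --> 0%E) <-> (forall e : R, 0 < e -> \forall n \near \oo, (u n <= e%:E)%E).
Proof.
move=> u0; split.
  move=> /fine_cvgP[ufin /cvgr0Pnorm_le h] e /h; apply: filterS2 ufin => n ufin.
  by rewrite -[in X in _ -> X](fineK ufin) lee_fin => /(le_trans (ler_norm _)).
move=> h; apply/fine_cvgP; split.
  apply: filterS (h 1 ltr01) => n un.
  by rewrite ge0_fin_numE// (le_lt_trans un)// ltry.
apply/cvgr0Pnorm_le => e /h; apply: filterS => n un.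
have ufin : u n \is a fin_num by rewrite ge0_fin_numE// (le_lt_trans un)// ltry.
by rewrite /= ger0_norm ?fine_ge0// -lee_fin fineK.
Qed.

Section bochner_theory.
Import HBSimple.
Context {R : realType} {E : lmodType R}.
Variables (V : set E) (p : E -> \bar R).
Hypothesis sl : sublinear V p.
Let mu := @lebesgue_measure R.

Lemma sublN u : V u -> V (- u).
Proof. by rewrite -scaleN1r; exact: (sublZ sl). Qed.

Lemma sublB u v : V u -> V v -> V (u - v).
Proof. by move=> Vu Vv; apply: (sublD sl) => //; exact: sublN. Qed.

Lemma subl_leN u : V u -> (p (- u) <= p u)%E.
Proof.
by move=> Vu; rewrite -scaleN1r (le_trans (subl_leZ sl _ Vu))// normrN1 mul1e.
Qed.

Lemma subl_le_dist u v : V u -> V v -> (p v <= p (u - v)%R + p u)%E.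
Proof.
move=> Vu Vv; have {1}-> : v = - (u - v) + u by rewrite opprB subrK.
rewrite (le_trans (subl_leD sl _ Vu)) ?leeD2r ?subl_leN//; first exact: sublN (sublB _ _).
exact: sublB.
Qed.

Lemma simple_val_in s t : simple_wf V s -> V (simple_val s t).
Proof.
elim: s => [_|a s IH wf]; first by rewrite /simple_val big_nil; exact: (subl0 sl).
rewrite /simple_val big_cons; apply: (sublD sl); last first.
  by apply: IH => b bs; apply: wf; rewrite inE bs orbT.
by apply: (sublZ sl); have [] := wf a (mem_head _ _).
Qed.

Lemma simple_integral_in D s : simple_wf V s -> V (simple_integral D s).
Proof.
elim: s => [_|a s IH wf]; first by rewrite /simple_integral big_nil; exact: (subl0 sl).
rewrite /simple_integral big_cons; apply: (sublD sl); last first.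
  by apply: IH => b bs; apply: wf; rewrite inE bs orbT.
by apply: (sublZ sl); have [] := wf a (mem_head _ _).
Qed.

Lemma simple_val_cons (a : set R * E) s t c : c + simple_val (a :: s) t =
  if t \in a.1 then (c + a.2) + simple_val s t else c + simple_val s t.
Proof.
rewrite /simple_val big_cons indicE; case: (t \in a.1) => /=.
  by rewrite scale1r addrA.
by rewrite scale0r add0r.
Qed.

Lemma simple_wf_cons a s : simple_wf V (a :: s) ->
  [/\ measurable a.1, V a.2 & simple_wf V s].
Proof.
move=> wf; have [? ?] := wf a (mem_head _ _); split => //.
by move=> b bs; apply: wf; rewrite inE bs orbT.
Qed.

(** No measurability of p is involved: the function takes finitely many values, on measurable sets.
    The constant c collects the vectors of the sets already decided. *)
Lemma measurable_subl_simple s c : simple_wf V s ->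
  measurable_fun setT (fun t => p (c + simple_val s t)).
Proof.
elim: s c => [|a s IH] c.
  by move=> _; under eq_fun do rewrite /simple_val big_nil; exact: measurable_cst.
move=> /simple_wf_cons[ma Va wf]; under eq_fun do rewrite simple_val_cons fun_if.
apply: measurable_fun_ifT; [|exact: IH|exact: IH].
apply: (@measurable_fun_bool _ _ _ _ true); rewrite setTI.
by rewrite (_ : _ @^-1` _ = a.1)//; apply/seteqP; split => t /= => [/set_mem|/mem_set].
Qed.

(** The sets of a simple function may overlap. The first one cuts D into two pieces, on each of
    which its vector contributes a constant, absorbed into c; hence an induction with D and c both
    general. *)
Lemma subl_simple_integral_le_cst D s c : measurable D -> (mu D < +oo)%E ->
  V c -> simple_wf V s ->
  (p (fine (mu D) *: c + simple_integral D s)%R <=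
   \int[mu]_(t in D) p (c + simple_val s t)%R)%E.
Proof.
elim: s D c => [|a s IH] D c mD Doo Vc.
  move=> _; rewrite /simple_integral big_nil addr0.
  under eq_integral do rewrite /simple_val big_nil addr0.
  rewrite integral_cst// (le_trans (subl_leZ sl _ Vc))// ger0_norm ?fine_ge0//.
  by rewrite fineK ?ge0_fin_numE// muleC.
move=> wfa; have [ma Va wf] := simple_wf_cons wfa.
pose D1 := D `&` a.1; pose D2 := D `\` a.1.
have mD1 : measurable D1 by exact: measurableI.
have mD2 : measurable D2 by exact: measurableD.
have DE : D = D1 `|` D2 by rewrite setUIDK.
have D10 : [disjoint D1 & D2].
  by apply/disj_setPS => x [[_ ?] [_ ?]].
have D1oo : (mu D1 < +oo)%E.
  by apply: le_lt_trans Doo; rewrite le_measure ?inE//; exact: subIsetl.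
have D2oo : (mu D2 < +oo)%E.
  by apply: le_lt_trans Doo; rewrite le_measure ?inE//; exact: subDsetl.
have muE A : measurable A ->
    fine (mu (A `&` D)) = fine (mu (A `&` D1)) + fine (mu (A `&` D2)).
  move=> mA; rewrite -fineD; last 2 first.
  - rewrite ge0_fin_numE//; apply: le_lt_trans D1oo.
    by rewrite le_measure ?inE//; exact: measurableI.
  - rewrite ge0_fin_numE//; apply: le_lt_trans D2oo.
    by rewrite le_measure ?inE//; exact: measurableI.
  rewrite -measureU//; [|exact: measurableI|exact: measurableI|].
    by rewrite -setIUr -DE.
  by rewrite setIACA (_ : D1 `&` D2 = set0) ?setI0//; exact/disj_set2P.
have intE : simple_integral D s = simple_integral D1 s + simple_integral D2 s.
  rewrite /simple_integral -big_split/=; apply: eq_big_seq => b bs.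
  by rewrite -scalerDl muE//; exact: (wf b bs).1.
rewrite [X in (_ <= integral mu X _)%E]DE ge0_integral_setU//; last first.
- by move=> x _; exact: (subl_ge0 sl).
- by apply: measurable_funTS; exact: measurable_subl_simple.
have VcD : V (c + a.2) by exact: (sublD sl).
rewrite (_ : _ + _ = (fine (mu D1) *: (c + a.2) + simple_integral D1 s)
   + (fine (mu D2) *: c + simple_integral D2 s)); last first.
  rewrite {1}/simple_integral big_cons -/(simple_integral D s) intE.
  have := muE setT measurableT; rewrite !setTI => ->.
  have -> : a.1 `&` D = D1 by rewrite setIC.
  rewrite scalerDl scalerDr -!addrA; congr (_ + _).
  by rewrite [LHS]addrCA; congr (_ + _); rewrite [LHS]addrCA.
apply: (le_trans (subl_leD sl _ _)).
- by apply: (sublD sl); [exact: (sublZ sl)|exact: simple_integral_in].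
- by apply: (sublD sl); [exact: (sublZ sl)|exact: simple_integral_in].
apply: leeD.
  rewrite (le_trans (IH _ _ mD1 D1oo VcD wf))// le_eqVlt; apply/orP; left; apply/eqP.
  by apply: eq_integral => t; rewrite inE => -[_ ta]; rewrite simple_val_cons mem_set.
rewrite (le_trans (IH _ _ mD2 D2oo Vc wf))// le_eqVlt; apply/orP; left; apply/eqP.
apply: eq_integral => t; rewrite inE => -[_ ta]; rewrite simple_val_cons.
by rewrite memNset.
Qed.

Lemma subl_simple_integral_le D s : measurable D -> (mu D < +oo)%E ->
  simple_wf V s ->
  (p (simple_integral D s) <= \int[mu]_(t in D) p (simple_val s t))%E.
Proof.
move=> mD Doo wf; have := subl_simple_integral_le_cst mD Doo (subl0 sl) wf.
rewrite scaler0 add0r => /le_trans; apply.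
by rewrite le_eqVlt; apply/orP; left; apply/eqP/eq_integral => t _; rewrite add0r.
Qed.

(** With s_n the approximating simple functions, p I is at most p (I - int s_n) + int p(s_n), and
    p(s_n) <= p(F - s_n) + G almost everywhere. The sum is split although p(F - s_n) may fail to be
    measurable, because G is measurable. *)
Lemma bochner_integral_le D F I (G : R -> \bar R) :
  measurable D -> (mu D < +oo)%E -> is_bochner_integral V p D F I ->
  measurable_fun D G -> (forall t, D t -> (0 <= G t)%E) ->
  {ae mu, forall t, D t -> V (F t) /\ (p (F t) <= G t)%E} ->
  (p I <= \int[mu]_(t in D) G t)%E.
Proof.
move=> mD Doo [VI [s [[wf _] cF cI]]] mG G0 FG.
apply/lee_addgt0Pr => e e0; have e20 : 0 < e / 2 by rewrite divr_gt0.
have/(ge0_ecvg0P _).1/(_ _ e20) cF' := cF; have/(ge0_ecvg0P _).1/(_ _ e20) cI' := cI.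
have {}cF' := cF' (fun n => integral_ge0 _ (fun t _ => subl_ge0 sl _)).
have {}cI' := cI' (fun n => subl_ge0 sl _).
near \oo => n.
have Fn : (\int[mu]_(t in D) p (F t - simple_val (s n) t)%R <= (e / 2)%:E)%E by near: n.
have In : (p (I - simple_integral D (s n))%R <= (e / 2)%:E)%E by near: n.
have VS := simple_integral_in D (wf n).
have -> : I = (I - simple_integral D (s n)) + simple_integral D (s n) by rewrite subrK.
rewrite (le_trans (subl_leD sl _ _))//; first exact: sublB.
rewrite (splitr e) EFinD addeA [leRHS]addeC leeD//.
rewrite (le_trans (subl_simple_integral_le mD Doo (wf n)))//.
apply: (@le_trans _ _ (\int[mu]_(t in D) (p (F t - simple_val (s n) t)%R + G t))%E).
  apply: ae_le_lower_integral.
  - by move=> t _; exact: (subl_ge0 sl).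
  - by move=> t Dt; rewrite adde_ge0// ?(subl_ge0 sl)// G0.
  apply: filterS FG => t FG Dt; have [VF FG'] := FG Dt.
  by rewrite (le_trans (subl_le_dist VF (simple_val_in _ (wf n))))// leeD2l.
rewrite (le_trans (lower_integralD _ _ _ _ _))//.
  by move=> t _; exact: (subl_ge0 sl).
by rewrite addeC leeD2l.
Unshelve. all: by end_near. Qed.

Lemma simple_wf_cat s s' : simple_wf V s -> simple_wf V s' -> simple_wf V (s ++ s').
Proof. by move=> ws ws' a; rewrite mem_cat => /orP[/ws|/ws']. Qed.

Definition simple_of_sfun (g : {sfun (measurableTypeR R) >-> R}) (e : E) : seq (set R * E) :=
  [seq (g @^-1` [set y], y *: e) | y <- finmap.enum_fset (fset_set (range g))].

Lemma simple_of_sfun_wf (g : {sfun (measurableTypeR R) >-> R}) e :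
  V e -> simple_wf V (simple_of_sfun g e).
Proof.
move=> Ve a /mapP[y _ ->] /=; split; last exact: (sublZ sl).
have mg : measurable (g @^-1` [set y] : set (measurableTypeR R)).
  exact: measurable_funPTI.
exact: mg.
Qed.

Lemma sfun_fsetE (g : {sfun (measurableTypeR R) >-> R}) t :
  g t = \sum_(y <- finmap.enum_fset (fset_set (range g))) y * \1_(g @^-1` [set y]) t.
Proof. by rewrite {1}fimfunE fsbig_finite. Qed.

Lemma simple_val_sfun (g : {sfun (measurableTypeR R) >-> R}) e t :
  simple_val (simple_of_sfun g e) t = g t *: e.
Proof.
rewrite sfun_fsetE scaler_suml /simple_val big_map.
by apply: eq_bigr => y _ /=; rewrite scalerA mulrC.
Qed.

Lemma simple_integral_sfun D (g : {sfun (measurableTypeR R) >-> R}) e :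
  measurable D -> (mu D < +oo)%E ->
  simple_integral D (simple_of_sfun g e) = (\int[mu]_(t in D) g t)%R *: e.
Proof.
move=> mD Doo; rewrite /simple_integral big_map.
have mg y : measurable (g @^-1` [set y]) by exact: measurable_funPTI.
have int1 y : mu.-integrable D (EFin \o (fun t => y * \1_(g @^-1` [set y]) t)).
  apply: measurable_bounded_integrable => //.
    by apply: measurable_funM => //; exact: measurable_indic.
  exists `|y|; split; first exact: num_real.
  move=> M yM t _ /=; rewrite normrM (le_trans _ (ltW yM))//.
  by rewrite ler_piMr// indicE; case: (_ \in _); rewrite ?normr1 ?normr0.
under [in RHS]eq_Rintegral do rewrite sfun_fsetE.
have key (s : seq R) : (\int[mu]_(t in D) \sum_(y <- s) y * \1_(g @^-1` [set y]) t)%R =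
   \sum_(y <- s) y * fine (mu ((g @^-1` [set y]) `&` D)).
  elim: s => [|y s IH].
    under eq_Rintegral do rewrite big_nil.
    by rewrite big_nil Rintegral_cst// mul0r.
  under eq_Rintegral do rewrite big_cons.
  rewrite RintegralD//; last first.
    rewrite (_ : _ \o _ = fun t => (\sum_(y <- s) (y * \1_(g @^-1` [set y]) t)%:E)%E).
      by apply: integrable_sum => // z _; exact: int1.
    by apply/funext => t /=; rewrite sumEFin.
  rewrite big_cons IH; congr (_ + _).
  rewrite RintegralZl//.
    by rewrite /Rintegral integral_indic.
  apply: measurable_bounded_integrable => //.
  exists 1; split; first exact: num_real.
  move=> M yM t _ /=; rewrite (le_trans _ (ltW yM))//.
  by rewrite indicE; case: (_ \in _); rewrite ?normr1 ?normr0.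
by rewrite key scaler_suml; apply: eq_bigr => y _ /=; rewrite scalerA mulrC.
Qed.

(** Serves to recentre an integral against a scalar kernel of known integral, replacing u by u -
    u(s). The approximating lists are those of F followed by -e times scalar simple functions
    tending to g in L^1. *)
Lemma bochner_integral_subZ D F I (g : R -> R) e :
  measurable D -> (mu D < +oo)%E -> is_bochner_integral V p D F I ->
  {ae mu, forall t, D t -> V (F t)} -> V e -> mu.-integrable D (EFin \o g) ->
  is_bochner_integral V p D (fun t => F t - g t *: e)
    (I - (\int[mu]_(t in D) g t)%R *: e).
Proof.
move=> mD Doo [VI [s [[wf sF] cF cI]]] VF Ve ig; split.
  by apply: sublB => //; exact: (sublZ sl).
have [h [ih hg hL1]] := approximation_sfun_integrable mD ig.
pose s' n := s n ++ simple_of_sfun (h n) (- e).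
have VNe : V (- e) by exact: sublN.
have valE n t : simple_val (s' n) t = simple_val (s n) t - h n t *: e.
  by rewrite /s' /simple_val big_cat/= -!/(simple_val _ _) simple_val_sfun scalerN.
have wf' n : simple_wf V (s' n).
  by apply: simple_wf_cat => //; exact: simple_of_sfun_wf.
have zmE (a b c b' : E) : a - b - (c - b') = (a - c) + (b' - b).
  by rewrite opprB addrACA [RHS]addrACA [- b - c]addrC.
have pe0 := subl_ge0 sl e; have pefin : p e \is a fin_num.
  by rewrite ge0_fin_numE// (subl_fin sl).
have dist t n : V (F t) -> (p (F t - g t *: e - simple_val (s' n) t)%R <=
    p (F t - simple_val (s n) t)%R + `|(g t)%:E - (h n t)%:E| * p e)%E.
  move=> VFt; rewrite valE (_ : _ - _ - _ =
    (F t - simple_val (s n) t) + (h n t - g t) *: e); last first.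
    by rewrite scalerBl zmE.
  have VFs : V (F t - simple_val (s n) t).
    by apply: sublB => //; exact: simple_val_in.
  rewrite (le_trans (subl_leD sl VFs (sublZ sl _ Ve)))// leeD2l//.
  by rewrite (le_trans (subl_leZ sl _ Ve))// -EFinB distrC.
exists s'; split.
- split=> //; apply: filterS2 VF sF => t VF sF Dt.
  have {}VF := VF Dt; have {}sF := sF Dt.
  have -> : 0%E = (0 + 0 * p e)%E by rewrite mul0e adde0.
  apply: (@squeeze_cvge _ _ _ _ (cst 0%E) _
     (fun n => p (F t - simple_val (s n) t)%R + `|(g t)%:E - (h n t)%:E| * p e)%E).
  + by apply: nearW => n; rewrite (subl_ge0 sl) dist.
  + by rewrite mul0e adde0; exact: cvg_cst.
  + apply: cvgeD; [by rewrite mul0e|exact: sF|].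
    apply: cvgeZr => //.
    have -> : 0%E = `|(g t)%:E - (g t)%:E|%E by rewrite subee// abse0.
    apply: cvg_abse; apply: cvgeB => //; first exact: cvg_cst.
    exact: hg.
- have -> : 0%E = (0 + 0 * p e)%E by rewrite mul0e adde0.
  apply: (@squeeze_cvge _ _ _ _ (cst 0%E) _
     (fun n => \int[mu]_(t in D) p (F t - simple_val (s n) t)%R +
        \int[mu]_(t in D) `|(g t)%:E - (h n t)%:E| * p e)%E).
  + apply: nearW => n; rewrite integral_ge0/=; last by move=> t _; exact: (subl_ge0 sl).
    have mgh : measurable_fun D (fun t => `|(g t)%:E - (h n t)%:E|)%E.
      apply: measurableT_comp => //; apply: emeasurable_funB.
        by have /integrableP[] := ig.
      by have /integrableP[] := ih n.
    rewrite -ge0_integralZr//.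
    apply: le_trans (lower_integralD _ _ _ _ _) => //; last 3 first.
    * by move=> t _; exact: (subl_ge0 sl).
    * by move=> t _; rewrite mule_ge0.
    * exact: emeasurable_funM.
    apply: ae_le_lower_integral.
    * by move=> t _; exact: (subl_ge0 sl).
    * by move=> t _; rewrite adde_ge0 ?(subl_ge0 sl)// mule_ge0.
    by apply: filterS VF => t VF Dt; exact: dist (VF Dt).
  + by rewrite mul0e adde0; exact: cvg_cst.
  + apply: cvgeD; [by rewrite mul0e|by []|].
    exact: cvgeZr.
- have -> : 0%E = (0 + 0 * p e)%E by rewrite mul0e adde0.
  apply: (@squeeze_cvge _ _ _ _ (cst 0%E) _
     (fun n => p (I - simple_integral D (s n))%R +
        \int[mu]_(t in D) `|(g t)%:E - (h n t)%:E| * p e)%E).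
  + apply: nearW => n; rewrite (subl_ge0 sl)/=.
    have -> : simple_integral D (s' n) =
        simple_integral D (s n) - (\int[mu]_(t in D) h n t)%R *: e.
      rewrite /s' /simple_integral big_cat/= -!/(simple_integral _ _).
      by rewrite simple_integral_sfun// scalerN.
    rewrite (_ : _ - _ - _ = (I - simple_integral D (s n)) +
       (\int[mu]_(t in D) h n t - \int[mu]_(t in D) g t)%R *: e); last first.
      by rewrite scalerBl zmE.
    have VIs : V (I - simple_integral D (s n)).
      by apply: sublB => //; exact: simple_integral_in.
    rewrite (le_trans (subl_leD sl VIs (sublZ sl _ Ve)))// leeD2l//.
    rewrite (le_trans (subl_leZ sl _ Ve))// lee_wpmul2r//.
    rewrite distrC -RintegralB// /Rintegral.
    have igh : mu.-integrable D (fun t => (g t)%:E - (h n t)%:E)%E.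
      by apply: integrableB => //; exact: ih.
    rewrite -fine_abse ?fineK; last 2 first.
    * by rewrite abse_fin_num; exact: integrable_fin_num.
    * exact: integrable_fin_num.
    by apply: le_abse_integral => //; have /integrableP[] := igh.
  + by rewrite mul0e adde0; exact: cvg_cst.
  + apply: cvgeD; [by rewrite mul0e|by []|].
    exact: cvgeZr.
Qed.

End bochner_theory.

(** * Smooth cutoffs *)

Section smooth_functions.
Context {R : realType}.
Implicit Types f g : R -> R.

(** Differentiability to order n through witnesses for the successive derivatives, so that products,
    inverses and affine changes of variable are handled by induction on n. *)
Fixpoint smoothn n f : Prop :=
  if n is m.+1 then
    exists2 df : R -> R, (forall t, is_derive t (1 : R) f (df t)) & smoothn m df
  else True.

Lemma smoothnW n f : smoothn n.+1 f -> smoothn n f.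
Proof.
elim: n f => [//|n IH] f [df fdf sdf]; exists df => //; exact: IH.
Qed.

Lemma smoothnD n f g : smoothn n f -> smoothn n g -> smoothn n (fun t => f t + g t).
Proof.
elim: n f g => [//|n IH] f g [df fdf sdf] [dg gdg sdg].
by exists (fun t => df t + dg t); [move=> t; exact: is_deriveD|exact: IH].
Qed.

Lemma smoothnM n f g : smoothn n f -> smoothn n g -> smoothn n (fun t => f t * g t).
Proof.
elim: n f g => [//|n IH] f g sf sg.
have sf' := smoothnW sf; have sg' := smoothnW sg.
case: sf sg => [df fdf sdf] [dg gdg sdg].
exists (fun t => f t * dg t + g t * df t); first by move=> t; exact: is_deriveM.
by apply: smoothnD; exact: IH.
Qed.

Lemma smoothn_cst n (c : R) : smoothn n (fun=> c).
Proof. by elim: n c => // n IH c; exists (fun=> 0) => // t; exact: is_derive_cst. Qed.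

Lemma smoothnV n f : (forall t, f t != 0) -> smoothn n f ->
  smoothn n (fun t => (f t)^-1).
Proof.
move=> f0; elim: n f f0 => [//|n IH] f f0 sf.
have sf' := smoothnW sf; case: sf => df fdf sdf.
exists (fun t => - 1 * ((f t)^-1 * (f t)^-1 * df t)).
  move=> t; apply: DeriveDef; first exact: derivableV.
  rewrite deriveV// derive_val -[_ *: _]/(_ * _).
  by rewrite mulN1r mulNr -exprVn expr2.
by apply: smoothnM; [exact: smoothn_cst|apply: smoothnM => //; apply: smoothnM; exact: IH].
Qed.

Lemma smoothn_affine n f a b : smoothn n f -> smoothn n (fun t => f (a * t + b)).
Proof.
elim: n f => [//|n IH] f [df fdf sdf].
exists (fun t => df (a * t + b) * a); last by apply: smoothnM; [exact: IH|exact: smoothn_cst].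
move=> t; have aff : is_derive t (1 : R) (fun t => a * t + b) a.
  have := @is_deriveD _ _ _ (fun t => a * t) (cst b) t 1 a 0.
  by rewrite addr0; apply; rewrite -[X in is_derive _ _ _ X]mulr1; exact: is_deriveZ.
exact: (@is_derive1_comp _ f (fun t => a * t + b)).
Qed.

Lemma smoothn_derivable n f t : (forall n, smoothn n f) ->
  derivable (derive1n n f) t 1.
Proof.
move=> sf; elim: n f sf => [|n IH] f sf; first by have [df /(_ t) []] := sf 1%N.
rewrite derive1Sn; apply: IH => m; have [df fdf sdf] := sf m.+1.
suff -> : derive1 f = df by [].
by apply/funext => u; rewrite derive1E derive_val.
Qed.

(** x^-k exp(-1/x), extended by 0 for x <= 0. The derivatives of exp(-1/x) stay in the span of this
    family, so one induction shows that all its members are smooth. *)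
Definition flat k (x : R) : R := if 0 < x then x ^- k * expR (- x^-1) else 0.

Lemma flat_ge0 k x : 0 <= flat k x.
Proof.
rewrite /flat; case: ifPn => // x0.
by rewrite mulr_ge0 ?expR_ge0// invr_ge0 exprn_ge0// ltW.
Qed.

(** exp y >= y^(k+1) / (k+1)! at y = 1/x. The linear bound is what makes the difference quotients at
    0 vanish in the limit. *)
Lemma flat_le k x : flat k x <= k.+1`!%:R * `|x|.
Proof.
rewrite /flat; case: ifPn => x0; last by rewrite mulr_ge0.
rewrite gtr0_norm// expRN; have := @expR_ge1Dxn _ x^-1 k; rewrite invr_ge0.
move=> /(_ (ltW x0)) h.
have xk : 0 < x ^+ k.+1 by rewrite exprn_gt0.
have f0 : 0 < k.+1`!%:R :> R by rewrite ltr0n fact_gt0.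
rewrite ler_pdivrMr ?expR_gt0//.
apply: (@le_trans _ _ (k.+1`!%:R * x * (x^-1 ^+ k.+1 / k.+1`!%:R))).
  rewrite le_eqVlt; apply/orP; left; apply/eqP.
  by rewrite exprVn exprS; field; rewrite expf_neq0 !gt_eqF.
by rewrite ler_pM2l ?mulr_gt0//; lra.
Qed.

Lemma is_derive_inv f x df : f x != 0 -> is_derive x (1 : R) f df ->
  is_derive x (1 : R) (fun y => (f y)^-1) (- (f x) ^- 2 * df).
Proof.
move=> fx0 fdf; apply: DeriveDef; first exact: derivableV.
by rewrite deriveV// derive_val.
Qed.

Lemma flat_pos k x : 0 < x -> flat k x = x ^- k * expR (- x^-1).
Proof. by rewrite /flat => ->. Qed.

Lemma flat_neg k x : x <= 0 -> flat k x = 0.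
Proof. by rewrite /flat leNgt => /negbTE ->. Qed.

Lemma is_derive_flat k x :
  is_derive x (1 : R) (flat k) (- k%:R * flat k.+1 x + flat k.+2 x).
Proof.
have [x0|x0|->] := ltgtP x 0.
- rewrite !flat_neg ?(ltW x0)// mulr0 addr0.
  apply: (@near_eq_is_derive _ _ _ (cst 0)).
  near=> y; rewrite flat_neg//.
  by apply: ltW; near: y; exact: lt_nbhsl.
- have xn0 : x != 0 by rewrite gt_eqF.
  have dX : is_derive x (1 : R) (fun y : R => y ^+ k) (k%:R * x ^+ k.-1).
    have := is_deriveX k (is_derive_id x (1 : R)).
    by rewrite scaler1 exprfctE.
  have dXV := @is_derive_inv (fun y => y ^+ k) x _ (expf_neq0 k xn0) dX.
  have dV := is_deriveN (@is_derive_inv id x _ xn0 (is_derive_id x (1 : R))).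
  have de : is_derive x (1 : R) (fun y => expR (- y^-1)) (expR (- x^-1) * (x ^- 2)).
    have := @is_derive1_comp _ expR (fun y => - y^-1) x _ _ _ dV.
    by rewrite mulNr opprK mulr1; apply.
  have nf : \near x, x ^- k * expR (- x^-1) = flat k x.
    by near=> y; rewrite flat_pos//; near: y; exact: lt_nbhsr.
  have := near_eq_is_derive nf (is_deriveM dXV de).
  set D := (X in is_derive _ _ _ X); move=> fD.
  suff <- : D = - k%:R * flat k.+1 x + flat k.+2 x by [].
  rewrite /D -![_ *: _]/(_ * _) !flat_pos// -exprM muln2 -addnn.
  case: k {dX dXV nf D fD} => [|k].
    by rewrite !expr0 !invr1 !mul0r mulr0 mulr0 oppr0 mul0r !add0r addr0 mul1r mulrC.
  rewrite /= !exprD !exprS expr0.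
  move: (expR _) (k.+1%:R) (x ^+ k) (expf_neq0 k xn0) => a b c c0.
  by field; rewrite xn0 c0.
- rewrite !flat_neg// mulr0 addr0.
  have h0 : (fun h : R => h^-1 *: (flat k (h *: 1 + 0) - flat k 0)) @ 0^' --> (0 : R).
    apply/cvgr0Pnorm_le => e e0; near=> h.
    rewrite [h *: 1]mulr1 addr0 [flat k 0]flat_neg// subr0.
    (* The difference quotient at 0 is again a member of the family. *)
    have -> : h^-1 *: flat k h = flat k.+1 h.
      have [hp|hn] := ltP 0 h; last by rewrite !flat_neg// scaler0.
      by rewrite !flat_pos// exprS invfM -[_ *: _]/(_ * _) mulrA.
    rewrite ger0_norm ?flat_ge0// (le_trans (flat_le _ _))//.
    rewrite mulrC -ler_pdivlMr ?ltr0n ?fact_gt0//.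
    near: h; apply: dnbhs0_le.
    by rewrite divr_gt0// ltr0n fact_gt0.
  apply: DeriveDef; first by apply/cvg_ex; exists 0.
  exact: cvg_lim h0.
Unshelve. all: by end_near. Qed.

Lemma smoothn_flat n k : smoothn n (flat k).
Proof.
elim: n k => [//|n IH] k.
exists (fun x => - k%:R * flat k.+1 x + flat k.+2 x); first by move=> t; exact: is_derive_flat.
by apply: smoothnD => //; apply: smoothnM => //; exact: smoothn_cst.
Qed.

(** The quotient of [flat 0 x] by [flat 0 x + flat 0 (1 - x)], whose denominator is positive since x
    > 0 or 1 - x > 0. B is the maximum of the modulus of the derivative on [0,1]; the derivative is
    zero elsewhere. *)
Lemma smooth_step : exists (theta : R -> R) (B : R),
  [/\ forall n, smoothn n theta, forall x, x <= 0 -> theta x = 0,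
      forall x, 1 <= x -> theta x = 1, forall x, 0 <= theta x <= 1 &
      forall x, `|derive1 theta x| <= B /\ (~~ (0 <= x <= 1) -> derive1 theta x = 0)].
Proof.
pose den x := flat 0 x + flat 0 (1 - x).
have den0 x : 0 < den x.
  rewrite /den; have [x0|x0] := ltP 0 x.
    by rewrite ltr_pwDl ?flat_ge0// flat_pos// expr0 invr1 mul1r expR_gt0.
  rewrite ltr_wpDl ?flat_ge0// flat_pos; last by lra.
  by rewrite expr0 invr1 mul1r expR_gt0.
pose theta x := flat 0 x * (den x)^-1.
have sth n : smoothn n theta.
  apply: smoothnM; first exact: smoothn_flat.
  apply: smoothnV; first by move=> t; rewrite gt_eqF.
  apply: smoothnD; first exact: smoothn_flat.
  have := smoothn_affine (-1) 1 (smoothn_flat n 0).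
  by under eq_fun do rewrite mulN1r addrC.
have th0 x : x <= 0 -> theta x = 0 by move=> x0; rewrite /theta flat_neg// mul0r.
have th1 x : 1 <= x -> theta x = 1.
  move=> x1; rewrite /theta; have := den0 x.
  rewrite /den [flat 0 (1 - x)]flat_neg ?addr0; last by lra.
  by move=> h; rewrite divff// gt_eqF.
have th01 x : 0 <= theta x <= 1.
  rewrite divr_ge0 ?flat_ge0 ?(ltW (den0 x))//= ler_pdivrMr// mul1r /den lerDl.
  exact: flat_ge0.
have dth_out x : ~~ (0 <= x <= 1) -> derive1 theta x = 0.
  rewrite negb_and -!ltNge => /orP[x0|x1]; rewrite derive1E.
    rewrite (@near_eq_derive _ R R _ (cst (0 : R))) ?derive_cst//.
    by near=> y; apply: th0; apply: ltW; near: y; exact: lt_nbhsl.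
  rewrite (@near_eq_derive _ R R _ (cst (1 : R))) ?derive_cst//.
  by near=> y; apply: th1; apply: ltW; near: y; exact: lt_nbhsr.
have cdth : continuous (fun x => `|derive1 theta x|).
  move=> x; apply: cvg_norm; apply: differentiable_continuous.
  by apply/derivable1_diffP; exact: (@smoothn_derivable 1 theta x sth).
have [c _ cmax] := @EVT_max R (fun x => `|derive1 theta x|) 0 1 ler01
  (continuous_subspaceT cdth).
exists theta, `|derive1 theta c|; split => // x; split; last exact: dth_out.
have [x01|/dth_out ->] := boolP (0 <= x <= 1); last by rewrite normr0.
by apply: cmax; rewrite in_itv.
Unshelve. all: by end_near. Qed.

End smooth_functions.

(** * Lebesgue points of vector-valued functions *)

Section vector_lebesgue_points.
Context {R : realType} {X : normedModType R}.
Local Notation mu := (@lebesgue_measure R).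

(** Each value is the sum of the vectors selected by a boolean mask, so the values of a sequence of
    simple functions are enumerated by the pairs of an index and a mask. *)
Lemma simple_val_mask (s : seq (set R * X)) t :
  simple_val s t = \sum_(a <- mask [seq t \in a.1 | a <- s] s) a.2.
Proof.
rewrite -filter_mask big_filter [RHS]big_mkcond/=; apply: eq_bigr => a _.
by rewrite indicE; case: (_ \in _); rewrite ?scale1r ?scale0r.
Qed.

(* Applying the scalar Lebesgue theorem to |f - c|, with c ranging over the
   countably many values of the approximating simple functions. *)
Lemma vector_lebesgue_pt (D : set R) (f : R -> X) (M : R) :
  measurable D -> (mu D < +oo)%E ->
  strongly_measurable setT (fun x : X => `|x|%:E) D f ->
  {ae mu, forall t, D t -> `|f t| <= M} ->
  {ae mu, forall s, D s -> forall del : R, 0 < del ->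
    exists G : R -> \bar R, [/\ measurable_fun setT G, forall t, (0 <= G t)%E,
      {ae mu, forall t, D t -> (`|f t - f s|%:E <= G t)%E} &
      \forall e \near (0 : R)^'+,
        (\int[mu]_(t in ball s e) G t <= (del * e)%:E)%E]}.
Proof.
move=> mD Doo [s [wf sf]] fM.
have aeF : Filter (almost_everywhere mu) by exact: ae_filter_ringOfSetsType.
pose C (k : nat) : X := if unpickle k is Some (n, m)
  then \sum_(a <- mask m (s n)) a.2 else 0.
(* A measurable version of |f - c|, since f is only an a.e. limit of simple functions. The
   truncation, inactive where |f| <= M, makes it bounded and hence integrable on D. *)
pose h c (t : R) : R :=
  fine (mine (limn_esup (fun n => `|simple_val (s n) t - c|%:E)) (`|M| + `|c|)%:E).
have B0 (c : X) : 0 <= `|M| + `|c| by rewrite addr_ge0.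
have esup0 c t : (0 <= limn_esup (fun n => `|simple_val (s n) t - c|%:E))%E.
  rewrite limn_esup_lim; apply: lime_ge; first exact: is_cvg_esups.
  by apply: nearW => n; apply: le_trans (ereal_sup_ubound _); last by exists n => //=.
have mh c : measurable_fun setT (h c).
  apply: measurableT_comp => //; apply: measurable_mine => //.
  apply: measurable_fun_limn_esup => n.
  have := @measurable_subl_simple _ _ _ (fun x : X => `|x|%:E) (s n) (- c) (wf n).
  by under eq_fun do rewrite addrC.
have h0 c t : 0 <= h c t.
  by rewrite fine_ge0// le_min esup0 lee_fin B0.
have hB c t : h c t <= `|M| + `|c|.
  rewrite /h; set m := mine _ _.
  have m0 : (0 <= m)%E by rewrite /m le_min esup0 lee_fin B0.
  have mB : (m <= (`|M| + `|c|)%:E)%E by rewrite /m ge_min lexx orbT.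
  by rewrite -lee_fin fineK// ge0_fin_numE// (le_lt_trans mB)// ltry.
have hE : {ae mu, forall t, D t -> forall c, h c t = `|f t - c|}.
  apply: filterS2 sf fM => t sf fM Dt c.
  have fc : (fun n => `|simple_val (s n) t - c|%:E) @ \oo --> `|f t - c|%:E.
    have /(ge0_ecvg0P _).1 := sf Dt => /(_ (fun n => _)) sf'.
    apply/fine_cvgP; split; first exact: nearW.
    apply/cvgrPdist_le => e e0; have := sf' (fun n => normr_ge0 _) e e0.
    apply: filterS => n; rewrite lee_fin /= => /(le_trans _); apply.
    by rewrite (le_trans (ler_dist_dist _ _))// opprB addrA subrK.
  rewrite /h is_cvg_limn_esupE; last by apply/cvg_ex; eexists; exact: fc.
  rewrite (cvg_lim _ fc)// min_l// lee_fin (le_trans (ler_normB _ _))// lerD2r.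
  by rewrite (le_trans (fM Dt))// ler_norm.
have hL : {ae mu, forall x, forall k, lebesgue_pt ((h (C k)) \_ D) x}.
  apply: ae_foralln => k; apply: lebesgue_differentiation.
  apply: open_integrable_locally; first exact: openT.
  rewrite -restrict_EFin. apply: (integrable_mkcond (mu := mu) (EFin \o h (C k)) mD).1.
  apply: measurable_bounded_integrable => //; first exact: measurable_funTS (mh _).
  exists (`|M| + `|C k|); split; first exact: num_real.
  by move=> B MB x _; rewrite /= ger0_norm// (le_trans (hB _ _))// ltW.
move: (sf) (hE) (hL); apply: filterS3 => x sfx hEx hLx Dx del del0.
(* The ball of radius e has length 2e: the constant part 2 (del/8) of the majorant and an average of
   at most del/4 for its other part each contribute del e / 2. *)
have [n fn] : exists n, `|f x - simple_val (s n) x| <= del / 8.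
  have /(ge0_ecvg0P _).1/(_ _ (divr_gt0 del0 _)) := sfx Dx.
  move=> /(_ (fun n => normr_ge0 _) 8)[]; first by [].
  by move=> n _ /(_ n (leqnn n)); rewrite lee_fin => ?; exists n.
pose k := pickle (n, [seq x \in a.1 | a <- s n]).
have Ck : C k = simple_val (s n) x by rewrite /C /k pickleK -simple_val_mask.
rewrite -Ck in fn; pose c := C k; pose g := (h c) \_ D.
have gx : g x = `|f x - c| by rewrite /g patchE mem_set// hEx.
(* |f t - f x| <= |f t - c| + |f x - c| = (|f t - c| - |f x - c|) + 2 |f x - c|, with g = |f - c|
   almost everywhere on D. *)
exists (fun t => `|(g t - g x)%:E| + (2 * `|f x - c|)%:E)%E.
have mg : measurable_fun setT (fun t => `|(g t - g x)%:E|)%E.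
  apply: measurableT_comp => //; apply/measurable_EFinP; apply: measurable_funB => //.
  by apply/(measurable_restrictT _ mD); exact: measurable_funTS.
split.
- by apply: emeasurable_funD => //; exact: measurable_cst.
- by move=> t; rewrite adde_ge0// lee_fin mulr_ge0.
- apply: filterS hE => t hEt Dt.
  have -> : g t = `|f t - c| by rewrite /g patchE mem_set// hEt.
  rewrite /= -EFinD lee_fin gx.
  have : `|f t - f x| <= `|f t - c| + `|f x - c|.
    by have := ler_distD c (f t) (f x); rewrite [`|c - f x|]distrC.
  have := ler_norm (`|f t - c| - `|f x - c|); lra.
have del4 : (0 < (del / 4)%:E)%E by rewrite lte_fin divr_gt0.
have L := hLx k; near=> e.
have e0 : 0 < e by near: e; exact: nbhs_right_gt.
have davgle : (davg g x e <= (del / 4)%:E)%E.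
  have [dfin dle] : davg g x e \is a fin_num /\ `|fine (davg g x e)| <= del / 4.
    split; near: e; have /fine_cvgP[h1 h2] := L; first exact: h1.
    by move/cvgr0Pnorm_le : h2; apply; rewrite divr_gt0.
  by rewrite -(fineK dfin) lee_fin (le_trans (ler_norm _)).
have mb : measurable (ball x e) by exact: measurable_ball.
have mub : mu (ball x e) = (e *+ 2)%:E by rewrite lebesgue_measure_ball// ltW.
rewrite ge0_integralD//; last first.
  exact: measurable_funTS.
rewrite integral_cst// [X in (_ + _ * X)%E]mub.
have -> : del * e = (e *+ 2) * (del / 4) + (2 * (del / 8)) * (e *+ 2).
  by rewrite mulr2n; field.
rewrite [leRHS]EFinD leeD//; last first.
  by rewrite -EFinM lee_fin ler_wpM2r ?mulrn_wge0 ?(ltW e0)// ler_wpM2l.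
move: davgle; rewrite /davg /iavg mub.
have e20 : 0 < e *+ 2 by rewrite mulrn_wgt0.
rewrite inver gt_eqF// => davgle.
rewrite EFinM -lee_pdivrMl//.
Unshelve. all: by end_near. Qed.

End vector_lebesgue_points.

(** * Modulus of continuity from a weak derivative *)

Section smooth_cutoff.
Context {R : realType}.
Local Notation mu := (@lebesgue_measure R).

Lemma smoothn_continuous (f : R -> R) : (forall n, smoothn n f) -> continuous f.
Proof.
move=> sf x; apply: differentiable_continuous; apply/derivable1_diffP.
exact: (@smoothn_derivable _ 0 f x sf).
Qed.

Lemma smoothn_derive1 (f : R -> R) : (forall n, smoothn n f) ->
  forall n, smoothn n (derive1 f).
Proof.
move=> sf n; have [df fdf sdf] := sf n.+1.
suff -> : derive1 f = df by [].
by apply/funext => u; rewrite derive1E derive_val.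
Qed.

(** B depends on neither s nor e: the factor 1/e of the derivative is to be balanced by the factor e
    in the Lebesgue point estimate. *)
Lemma smooth_step_at : exists2 B : R, 0 <= B & forall s e : R, 0 < e ->
  exists st : R -> R, [/\ forall n, smoothn n st,
    (forall t, t <= s -> st t = 0) /\ (forall t, s + e <= t -> st t = 1),
    forall t, 0 <= st t <= 1, forall t, `|derive1 st t| <= B / e &
    forall t, derive1 st t != 0 -> s <= t <= s + e].
Proof.
have [th [B [sth th0 th1 th01 dth]]] := @smooth_step R.
have B0 : 0 <= B by apply: le_trans (dth 0).1.
exists B => // s e e0; exists (fun t => th (e^-1 * t + - s / e)).
have arg t : e^-1 * t + - s / e = (t - s) / e by field; rewrite gt_eqF.
have dE t : derive1 (fun t => th (e^-1 * t + - s / e)) t =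
    derive1 th ((t - s) / e) * e^-1.
  have [df fdf _] := sth 1%N.
  have aff : is_derive t (1 : R) (fun t => e^-1 * t + - s / e) e^-1.
    have := @is_deriveD _ _ _ (fun t => e^-1 * t) (cst (- s / e)) t 1 e^-1 0.
    by rewrite addr0; apply; rewrite -[X in is_derive _ _ _ X]mulr1; exact: is_deriveZ.
  rewrite derive1E (@derive_val _ _ _ _ _ _ _
    (@is_derive1_comp _ th (fun t => e^-1 * t + - s / e) t _ _ (fdf _) aff)).
  by rewrite derive1E arg derive_val.
split.
- by move=> n; exact: smoothn_affine.
- split=> t ts; rewrite arg; first by apply: th0; rewrite pmulr_lle0 ?invr_gt0// subr_le0.
  by apply: th1; rewrite ler_pdivlMr// mul1r lerBrDl.
- by move=> t; exact: th01.
- move=> t; rewrite dE normrM [X in _ * X]gtr0_norm ?invr_gt0//.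
  by rewrite ler_pM2r ?invr_gt0//; exact: (dth _).1.
- move=> t; rewrite dE mulf_eq0 invr_eq0 (gt_eqF e0) orbF => h.
  have : 0 <= (t - s) / e <= 1.
    by apply: contraNT h => /(dth _).2 ->.
  by rewrite pmulr_lge0 ?invr_gt0// subr_ge0 ler_pdivrMr// mul1r lerBlDl.
Qed.

Lemma Rintegral_derive1_smooth (f : R -> R) a b : a < b -> (forall n, smoothn n f) ->
  (\int[mu]_(t in `]a, b[) derive1 f t)%R = f b - f a.
Proof.
move=> ab sf; have cf := smoothn_continuous sf.
have cdf := smoothn_continuous (smoothn_derive1 sf).
rewrite /Rintegral -(@integral_itv_bndoo _ a b (EFin \o derive1 f) true false); last first.
  by apply: measurable_funTS; apply/measurable_EFinP; exact: continuous_measurable_fun.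
rewrite (@continuous_FTC2 _ (derive1 f) f)//.
- exact: continuous_subspaceT.
- split.
  + by move=> x _; exact: (@smoothn_derivable _ 0 f x sf).
  + by apply: cvg_at_right_filter; exact: cf.
  + by apply: cvg_at_left_filter; exact: cf.
Qed.

Lemma lebesgue_measure_itvoo_lty (a b : R) : (mu `]a, b[%classic < +oo)%E.
Proof. by rewrite lebesgue_measure_itv/=; case: ifP => _; rewrite ltry. Qed.

Lemma integrable_bounded_smooth (f : R -> R) a b B : (forall n, smoothn n f) ->
  (forall t, `|f t| <= B) -> mu.-integrable `]a, b[ (EFin \o f).
Proof.
move=> sf fB; apply: measurable_bounded_integrable => //.
- exact: lebesgue_measure_itvoo_lty.
- by apply: measurable_funTS; apply: continuous_measurable_fun; exact: smoothn_continuous.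
- exists B; split; first exact: num_real.
  by move=> M BM x _ /=; rewrite (le_trans (fB x))// ltW.
Qed.

End smooth_cutoff.

(** * Increments of a function between two of its Lebesgue points *)

Section weak_derivative_modulus.
Context {R : realType} {X : normedModType R} {E : lmodType R}.
Local Notation mu := (@lebesgue_measure R).
Variables (V : set E) (p : E -> \bar R) (T : R).
Hypothesis sl : sublinear V p.
Local Notation D := (`]0, T[%classic : set R).
Variables (f : R -> X) (u w : R -> E) (h : R -> \bar R).
Variables (C M : R) (al be : nat -> R).
Hypotheses (C0 : 0 <= C) (al0 : forall n, 0 <= al n) (be0 : forall n, 0 <= be n).
Hypothesis fsm : strongly_measurable setT (fun x : X => `|x|%:E) D f.
Hypothesis fM : {ae mu, forall t, D t -> `|f t| <= M}.
Hypothesis uV : forall t, V (u t).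
Hypothesis uf : forall s t, (p (u t - u s)%R <= (C * `|f t - f s|)%:E)%E.
Hypotheses (mh : measurable_fun setT h) (h0 : forall t, (0 <= h t)%E).
Hypothesis h1 : (\int[mu]_(t in D) h t <= 1)%E.
Hypothesis wh : {ae mu, forall t, D t -> V (w t) /\
  forall n, (p (w t) <= (al n)%:E + (be n)%:E * h t)%E}.
Hypothesis td : is_time_derivative T V p u w.

Let mD : measurable D. Proof. by []. Qed.
Let Doo : (mu D < +oo)%E. Proof. exact: lebesgue_measure_itvoo_lty. Qed.

(** The Lebesgue point property of f at s, with a measurable majorant G in place of |f - f s|. *)
Let good s := forall del : R, 0 < del ->
    exists G : R -> \bar R, [/\ measurable_fun setT G, forall t, (0 <= G t)%E,
      {ae mu, forall t, D t -> (`|f t - f s|%:E <= G t)%E} &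
      \forall e \near (0 : R)^'+,
        (\int[mu]_(t in ball s e) G t <= (del * e)%:E)%E].

(** g stands for the derivative of a smooth step on [s, s + e]. The radius 2e places this closed
    interval inside the open ball around s. *)
Lemma cutoff_term_le (g : R -> R) (G : R -> \bar R) s e B tau :
  0 < e -> 0 <= B -> (forall t, (0 <= G t)%E) ->
  `|g tau| <= B / e -> (g tau != 0 -> s <= tau <= s + e) ->
  (`|f tau - f s|%:E <= G tau)%E ->
  (`|g tau|%:E * p (u tau - u s)%R <= (B / e * C)%:E * (G \_ (ball s (2 * e))) tau)%E.
Proof.
move=> e0 B0 G0 gB gs fG.
have GG0 : (0 <= (G \_ (ball s (2 * e))) tau)%E by apply: erestrict_ge0 => t _.
have BC0 : 0 <= B / e * C by rewrite mulr_ge0// divr_ge0// ltW.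
have [->|g0] := eqVneq (g tau) 0; first by rewrite normr0 mul0e mule_ge0// lee_fin.
have /andP[st te] := gs g0.
rewrite patchE mem_set; last first.
  by rewrite /ball/= ltr_distlC; apply/andP; split; lra.
rewrite EFinM -muleA lee_pmul// ?(subl_ge0 sl) ?lee_fin//.
by rewrite (le_trans (uf _ _))// EFinM lee_wpmul2l// lee_fin.
Qed.

Lemma cutoff_integral_le (G : R -> \bar R) s e del : measurable_fun setT G ->
  (forall t, (0 <= G t)%E) -> (\int[mu]_(t in ball s (2 * e)) G t <= (del * (2 * e))%:E)%E ->
  (\int[mu]_(t in D) (G \_ (ball s (2 * e))) t <= (del * (2 * e))%:E)%E.
Proof.
move=> mG G0 /(le_trans _); apply; rewrite [leRHS]integral_mkcond.
apply: ge0_subset_integral => //.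
  by apply/(measurable_restrictT _ (measurable_ball _ _)); exact: measurable_funTS.
by move=> t _; apply: erestrict_ge0.
Qed.

(** Take psi = ss - tt, with ss and tt the smooth steps at s and t, and I the integral of psi' u. As
    ss' and tt' have integral 1, I - u s + u t is the integral of ss' (u - u s) - tt' (u - u t),
    which is small at Lebesgue points; and - I is the integral of psi w. The sum of the two is u t -
    u s. *)
Lemma weak_derivative_good s t n : D s -> D t -> good s -> good t -> s < t ->
  (p (u t - u s)%R <= (al n * (t - s) + be n)%:E)%E.
Proof.
rewrite /= !in_itv/= => /andP[s0 sT] /andP[t0 tT] gs gt st.
have aeF : Filter (almost_everywhere mu) by exact: ae_filter_ringOfSetsType.
have [B B0 /= step] := @smooth_step_at R.
apply/lee_addgt0Pr => eta eta0.
(* The recentred integral is at most 4 B C del, whatever e is; this choice makes it at most eta /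
   2. *)
pose del := eta / (8 * (B * C + 1)).
have BC0 : 0 <= B * C by rewrite mulr_ge0.
have del0 : 0 < del by rewrite divr_gt0// mulr_gt0// ltr_wpDl.
have [Gs [mGs Gs0 fGs Gsi]] := gs del del0.
have [Gt [mGt Gt0 fGt Gti]] := gt del del0.
(* t + e < T keeps the support of psi in (0,T), and al n e <= eta / 2 pays for its length t - s + e
   exceeding t - s. *)
have [e [e0 eT alE Gse Gte]] : exists e, [/\ 0 < e, t + e < T, al n * e <= eta / 2,
    (\int[mu]_(t in ball s (2 * e)) Gs t <= (del * (2 * e))%:E)%E &
    (\int[mu]_(x in ball t (2 * e)) Gt x <= (del * (2 * e))%:E)%E].
  near (0 : R)^'+ => r.
  have r0 : 0 < r by near: r; exact: nbhs_right_gt.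
  have rT : r < T - t by near: r; apply: nbhs_right_lt; rewrite subr_gt0.
  have ra : r < eta / (al n + 1).
    by near: r; apply: nbhs_right_lt; rewrite divr_gt0// ltr_wpDl.
  exists (r / 2); rewrite (_ : 2 * (r / 2) = r); last by field.
  split; [by rewrite divr_gt0| by lra | | by near: r | by near: r].
  move: ra; rewrite ltr_pdivlMr ?ltr_wpDl// => ra.
  have := al0 n; nra.
have [ss [sss [ss0 ss1] ss01 dssB dss]] := step s e e0.
have [tt [stt [tt0 tt1] tt01 dttB dtt]] := step t e e0.
pose psi x := ss x - tt x.
have spsi m : smoothn m psi.
  by apply: smoothnD => //; have := smoothn_affine; rewrite /psi;
     move=> _; under eq_fun do rewrite -mulN1r; apply: smoothnM => //; exact: smoothn_cst.
have dpsi x : derive1 psi x = derive1 ss x - derive1 tt x.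
  have [ds dsE _] := sss 1%N; have [dt dtE _] := stt 1%N.
  have := is_deriveB (dsE x) (dtE x) => dE.
  rewrite !derive1E (@derive_val _ _ _ _ _ _ _ (dsE x)) (@derive_val _ _ _ _ _ _ _ (dtE x)).
  exact: (@derive_val _ _ _ _ _ _ _ dE).
have psi_supp x : psi x != 0 -> s <= x <= t + e.
  apply: contraNT; rewrite negb_and -!ltNge /psi => /orP[xs|xt].
    by rewrite ss0 ?(ltW xs)// tt0 ?subrr// ltW// (lt_trans xs).
  by rewrite ss1 ?tt1 ?subrr// ?(ltW xt)//; lra.
have psi1 x : `|psi x| <= 1.
  rewrite /psi ler_norml; have := ss01 x; have := tt01 x.
  by move=> /andP[? ?] /andP[? ?]; apply/andP; split; lra.
have clpsi : closure [set x | psi x != 0] `<=` `[s, t + e].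
  rewrite closureE; apply: smallest_sub; first exact: itv_closed.
  by move=> x /= /psi_supp; rewrite in_itv.
have test : test_function T psi.
  split.
  - by move=> m x; exact: smoothn_derivable.
  - by apply: subclosed_compact clpsi; [exact: closed_closure|exact: segment_compact].
  - move=> x /clpsi /=; rewrite !in_itv/= => /andP[sx xe].
    by rewrite (lt_le_trans s0)//= (le_lt_trans xe).
have [I [bI bNI]] := td test.
have int_s : mu.-integrable D (EFin \o derive1 ss).
  exact: integrable_bounded_smooth (smoothn_derive1 sss) dssB.
have int_t : mu.-integrable D (EFin \o (fun x => - derive1 tt x)).
  apply: (@integrable_bounded_smooth _ _ _ _ (B / e)).
    move=> m; under eq_fun do rewrite -mulN1r.
    by apply: smoothnM; [exact: smoothn_cst|exact: smoothn_derive1].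
  by move=> x; rewrite normrN.
have T0 : 0 < T by exact: lt_trans sT.
have Ints : (\int[mu]_(x in D) derive1 ss x)%R = 1.
  by rewrite Rintegral_derive1_smooth// (ss0 0 (ltW s0)) ss1 ?subr0//; lra.
have Intt : (\int[mu]_(x in D) (- derive1 tt x))%R = - 1.
  under eq_Rintegral do rewrite -mulN1r.
  rewrite RintegralZl//; last exact: integrable_bounded_smooth (smoothn_derive1 stt) dttB.
  by rewrite Rintegral_derive1_smooth// (tt0 0 (ltW t0)) tt1 ?subr0 ?mulr1//; lra.
have VF : {ae mu, forall x, D x -> V (derive1 psi x *: u x)}.
  by apply: aeW => x _; exact: (sublZ sl).
have b1 := bochner_integral_subZ sl mD Doo bI VF (uV s) int_s.
have VF1 : {ae mu, forall x, D x -> V (derive1 psi x *: u x - derive1 ss x *: u s)}.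
  by apply: aeW => x _; apply: (sublB sl); exact: (sublZ sl).
have b2 := bochner_integral_subZ sl mD Doo b1 VF1 (uV t) int_t.
rewrite Ints Intt scaleN1r scale1r opprK in b2.
pose G x := ((B / e * C)%:E * ((Gs \_ (ball s (2 * e))) x + (Gt \_ (ball t (2 * e))) x))%E.
have BeC0 : 0 <= B / e * C by rewrite mulr_ge0// divr_ge0// ltW.
have GGs0 x : (0 <= (Gs \_ (ball s (2 * e))) x)%E by apply: erestrict_ge0.
have GGt0 x : (0 <= (Gt \_ (ball t (2 * e))) x)%E by apply: erestrict_ge0.
have mGGs : measurable_fun D (Gs \_ (ball s (2 * e))).
  apply: measurable_funTS; apply/(measurable_restrictT _ (measurable_ball _ _)).
  exact: measurable_funTS.
have mGGt : measurable_fun D (Gt \_ (ball t (2 * e))).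
  apply: measurable_funTS; apply/(measurable_restrictT _ (measurable_ball _ _)).
  exact: measurable_funTS.
have le2 : (p (I - u s + u t)%R <= (eta / 2)%:E)%E.
  apply: le_trans (bochner_integral_le sl (G := G) mD Doo b2 _ _ _) _.
  - by apply: measurable_funeM; exact: emeasurable_funD.
  - by move=> x _; rewrite mule_ge0 ?lee_fin// adde_ge0.
  - apply: filterS2 fGs fGt => x fGs fGt Dx; split.
      by apply: (sublB sl); [apply: (sublB sl)|]; exact: (sublZ sl).
    rewrite dpsi (_ : _ - _ - _ =
      derive1 ss x *: (u x - u s) + (- derive1 tt x) *: (u x - u t)); last first.
      have zmE (a b c d : E) : a - b - c - d = (a - c) + (- b - d).
        by rewrite -!addrA; congr (_ + _); rewrite addrCA.
      by rewrite scalerBl !scalerBr !scaleNr zmE.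
    have Vs : V (u x - u s) by exact: (sublB sl).
    have Vt : V (u x - u t) by exact: (sublB sl).
    rewrite (le_trans (subl_leD sl (sublZ sl _ Vs) (sublZ sl _ Vt)))//.
    rewrite /G ge0_muleDr// leeD//.
      rewrite (le_trans (subl_leZ sl _ Vs))//.
      by apply: cutoff_term_le => //; [exact: dss|exact: fGs].
    rewrite (le_trans (subl_leZ sl _ Vt))// normrN.
    by apply: cutoff_term_le => //; [exact: dtt|exact: fGt].
  - rewrite /G ge0_integralZl//; last 2 first.
    + exact: emeasurable_funD.
    + by move=> x _; rewrite adde_ge0.
    rewrite ge0_integralD//.
    apply: (@le_trans _ _ ((B / e * C)%:E * ((del * (2 * e))%:E + (del * (2 * e))%:E))%E).
      by rewrite lee_wpmul2l ?lee_fin// leeD//; exact: cutoff_integral_le.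
    rewrite -EFinD -EFinM lee_fin.
    have -> : B / e * C * (del * (2 * e) + del * (2 * e)) = (B * C) * (4 * del).
      by field; rewrite gt_eqF.
    rewrite /del.
    have -> : 4 * (eta / (8 * (B * C + 1))) = (eta / 2) / (B * C + 1).
      by field; rewrite gt_eqF// ltr_wpDl.
    rewrite mulrA ler_pdivrMr ?ltr_wpDl// mulrC ler_wpM2l ?divr_ge0 ?(ltW eta0)//.
    by rewrite lerDl.
(* The [al] term keeps the indicator of the support, to gain the factor t - s. In the other term h
   is integrated over all of (0,T), where its integral is at most 1. *)
pose H x := ((al n)%:E * (\1_`[s, t + e] x)%:E + (be n)%:E * h x)%E.
have H0 x : (0 <= (be n)%:E * h x)%E by rewrite mule_ge0 ?lee_fin.
have mhD : measurable_fun D h by exact: measurable_funTS.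
have mind : measurable_fun D (EFin \o (\1_`[s, t + e] : R -> R)).
  by apply/measurable_EFinP; exact: measurable_indic.
have leI : (p (- I)%R <= (al n * (t - s + e) + be n)%:E)%E.
  apply: le_trans (bochner_integral_le sl (G := H) mD Doo bNI _ _ _) _.
  - by apply: emeasurable_funD; exact: measurable_funeM.
  - by move=> x _; rewrite adde_ge0// mule_ge0// lee_fin.
  - apply: filterS wh => x whx Dx; have [Vw whn] := whx Dx.
    split; first exact: (sublZ sl).
    rewrite (le_trans (subl_leZ sl _ Vw))//.
    have [->|p0] := eqVneq (psi x) 0.
      by rewrite normr0 mul0e adde_ge0// mule_ge0// lee_fin.
    rewrite /H indicE mem_set; last by rewrite /= in_itv; exact: psi_supp.
    rewrite mule1 (le_trans _ (whn n))// -[leRHS]mul1e lee_wpmul2r ?lee_fin//.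
    exact: (subl_ge0 sl).
  - rewrite ge0_integralD//; last 3 first.
    + by move=> x _; rewrite mule_ge0// lee_fin.
    + exact: measurable_funeM.
    + exact: measurable_funeM.
    rewrite EFinD leeD//; last first.
      rewrite ge0_integralZl ?lee_fin//.
      by rewrite -[leRHS]mule1 lee_wpmul2l// lee_fin.
    rewrite ge0_integralZl ?lee_fin//.
    rewrite EFinM lee_wpmul2l ?lee_fin// integral_indic//.
    apply: (@le_trans _ _ (mu `[s, t + e]%classic)).
      by rewrite le_measure ?inE//; exact: measurableI.
    by rewrite lebesgue_measure_itv/= lte_fin ifT -?EFinB ?lee_fin; lra.
have zmE (a b c : E) : b - a = (c - a + b) + (- c).
  by rewrite -[c - a + b]addrA [c + _]addrC addrK addrC.
rewrite (zmE _ _ I).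
have [Vb2 _] := b2; have [VNI _] := bNI.
rewrite (le_trans (subl_leD sl Vb2 VNI))//.
apply: (le_trans (leeD le2 leI)); rewrite -!EFinD lee_fin mulrDr.
lra.
Unshelve. all: by end_near. Qed.

Lemma weak_derivative_modulus : exists S : set R,
  [/\ S `<=` D, {ae mu, forall t, D t -> S t} &
    forall s t n, S s -> S t -> s < t ->
      (p (u t - u s)%R <= (al n * (t - s) + be n)%:E)%E].
Proof.
have aeF : Filter (almost_everywhere mu) by exact: ae_filter_ringOfSetsType.
exists [set s | D s /\ good s]; split.
- by move=> s [].
- have := vector_lebesgue_pt mD Doo fsm fM.
  by apply: filterS => s gs Ds; split => //; exact: gs.
- move=> s t n [Ds gs] [Dt gt]; exact: weak_derivative_good.
Qed.

End weak_derivative_modulus.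

(** * Time slices *)

Section slices.
Context d1 d2 (T1 : measurableType d1) (T2 : measurableType d2) (R : realType).
Variable m1 : {sigma_finite_measure set T1 -> \bar R}.
Variable m2 : {sigma_finite_measure set T2 -> \bar R}.
Local Notation m12 := (m1 \x m2)%E.

(** By Tonelli, almost every section of a measurable null set containing the exceptional set is
    null. *)
Lemma ae_slice (P : T1 * T2 -> Prop) : {ae m12, forall z, P z} ->
  {ae m2, forall t, {ae m1, forall x, P (x, t)}}.
Proof.
move=> [A [mA A0 PA]].
have mi : measurable_fun setT (EFin \o (\1_A : T1 * T2 -> R)).
  by apply/measurable_EFinP; exact: measurable_indic.
have i0 (z : T1 * T2) : (0 <= (EFin \o (\1_A : T1 * T2 -> R)) z)%E.
  by rewrite lee_fin.
have G0 : (\int[m2]_t fubini_G m1 (EFin \o (\1_A : T1 * T2 -> R)) t = 0)%E.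
  rewrite -(fubini_tonelli2 (m1 := m1) (m2 := m2) _ mi i0) integral_indic// setIT.
  exact: A0.
have mG := measurable_fun_fubini_tonelli_G (m1 := m1) _ mi i0.
have : ae_eq m2 setT (fubini_G m1 (EFin \o (\1_A : T1 * T2 -> R))) (cst 0%E).
  apply/(ae_eq_integral_abs m2 measurableT mG).
  rewrite -[RHS]G0; apply: eq_integral => t _; rewrite gee0_abs//.
  by apply: integral_ge0 => x _.
apply: filterS => t /(_ I) /= Gt; exists (ysection A t); split.
- exact: measurable_ysection.
- by rewrite -Gt -[LHS]/((m1 \o ysection A) t) -indic_fubini_tonelli_GE.
- by move=> x /= nP; rewrite /ysection/= inE; exact: PA.
Qed.

Lemma ae_fst (P : T1 -> Prop) : {ae m1, forall x, P x} -> {ae m12, forall z, P z.1}.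
Proof.
move=> [A [mA A0 PA]]; exists (A `*` setT); split.
- exact: measurableX.
- apply: (eq_trans (product_measure1E m1 m2 mA measurableT)).
  (* The convention 0 * +oo = 0 covers an infinite [m2 setT]. *)
  exact: (eq_trans (congr1 (fun y => y * m2 setT)%E A0) (mul0e _)).
- by move=> [x t] /= nP; split => //; exact: PA.
Qed.

Variables (Om : set T1) (D : set T2) (K : R) (Phi : T1 -> R -> R).
Hypothesis mD : measurable D.
Hypothesis mPhi : musielak m1 Om K Phi.
Let Q := Om `*` D.
Let PhiQ := fun (z : T1 * T2) r => Phi z.1 r.
Let mOm := musielak_measurable_set mPhi.
Let mQ : measurable Q. Proof. exact: measurableX. Qed.

Lemma musielak_prod : musielak m12 Q K PhiQ.
Proof.
split => //.
- exact: (musielak_K mPhi).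
- by move=> [x t] r [/= Ox _]; exact: (musielak_ge0 mPhi).
- move=> r; have [g mg gP] := musielak_measurable mPhi r.
  exists (fun z => (g \_ Om) z.1).
    apply: measurable_funTS; apply: measurableT_comp => //.
    exact: (measurable_restrictT g mOm).1.
  apply: filterS (ae_fst gP) => -[x t] /= h [Ox _].
  by rewrite patchE mem_set//; exact: h.
- apply: filterS (ae_fst (musielak_young mPhi)) => -[x t] /= h [Ox _]; exact: h.
Qed.

(** h t is the modular over all of Omega of the slice of v / l at time t, computed from a measurable
    version of the integrand. Tonelli turns the modular bound for v / l on Q into the bound 1 on the
    integral of h, and [luxemburg_le_modular] applies to each slice. *)
Lemma slices_luxemburg (v : T1 * T2 -> R) (l : R) :
  Lphi m12 Q PhiQ v -> (luxemburg m12 Q PhiQ v < l%:E)%E ->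
  exists h : T2 -> \bar R,
  [/\ measurable_fun setT h, forall t, (0 <= h t)%E, (\int[m2]_(t in D) h t <= 1)%E &
    {ae m2, forall t, D t -> Lphi m1 Om Phi (fun x => v (x, t)) /\
      forall n, (luxemburg m1 Om Phi (fun x => v (x, t)) <=
        (l * (2 / K) ^- n)%:E + (l / 2 ^+ n)%:E * h t)%E}].
Proof.
move=> [mv _] vl; have mPhiQ := musielak_prod.
have [l0 rv] := luxemburg_lt mPhiQ mv vl.
have mvl : ae_measurable_fun m12 Q (fun z => v z / l).
  have := ae_measurableZ l^-1 mv; apply: ae_measurable_eq.
  by apply/aeW => z _; rewrite mulrC.
have [H [mH H0 HP]] := musielak_comp_measurable mPhiQ mvl.
pose H' := H \_ Q.
have mH' : measurable_fun setT H'.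
  by apply/(measurable_restrictT H mQ); exact: measurable_funTS.
have H'0 z : (0 <= H' z)%E by exact: erestrict_ge0.
pose h t := (\int[m1]_x H' (x, t))%E.
have mh : measurable_fun setT h := measurable_fun_fubini_tonelli_G (m1 := m1) _ mH' H'0.
have h0 t : (0 <= h t)%E by exact: integral_ge0.
have h1 : (\int[m2]_t h t <= 1)%E.
  rewrite -[X in (X <= _)%E](fubini_tonelli2 (m1 := m1) (m2 := m2) _ mH' H'0).
  by rewrite -integral_mkcond -(modular_measurableE mPhiQ H0 HP).
exists h; split => //.
  by apply: le_trans h1; apply: ge0_subset_integral.
(* Finiteness of h t is what puts the slice at time t in V. *)
have hfin : {ae m2, forall t, h t \is a fin_num}.
  have ih : m2.-integrable setT h.
    apply/integrableP; split => //; apply: le_lt_trans (ltry 1).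
    by apply: le_trans h1; rewrite le_eqVlt; apply/orP; left; apply/eqP;
       apply: eq_integral => t _; rewrite gee0_abs.
  by apply: filterS (integrable_ae measurableT ih) => t; exact.
have [g mg gP] := mv.
have sl1 := ae_slice gP; have sl2 := ae_slice HP.
apply: filterS3 hfin sl1 sl2 => t hfin sl1 sl2 Dt.
have rle : (modular m1 Om Phi (fun x => v (x, t) / l)%R <= h t)%E.
  apply: (@le_trans _ _ (\int[m1]_(x in Om) H' (x, t))%E).
    apply: ae_le_lower_integral => //.
      by move=> x Ox; rewrite lee_fin (musielak_ge0 mPhi).
    apply: filterS sl2 => x sl2 Ox.
    by rewrite /H' patchE mem_set//= -sl2.
  apply: ge0_subset_integral => //.
  exact: measurable_fun_pair1.
have mw : ae_measurable_fun m1 Om (fun x => v (x, t)).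
  exists (fun x => (g \_ Q) (x, t)).
    apply: measurable_funTS; apply: measurable_fun_pair1.
    exact: (measurable_restrictT g mQ).1.
  by apply: filterS sl1 => x sl1 Ox; rewrite patchE mem_set//; exact: sl1.
split; first split => //.
  exists l^-1; first by rewrite invr_gt0.
  rewrite (_ : modular _ _ _ _ = modular m1 Om Phi (fun x => v (x, t) / l)%R).
    by rewrite (le_lt_trans rle)// ltey_eq hfin.
  by congr modular; apply/funext => x; rewrite mulrC.
move=> n; apply: (le_trans (luxemburg_le_modular mPhi n mw l0)).
by rewrite leeD2l// lee_wpmul2l// lee_fin divr_ge0 ?(ltW l0).
Qed.

End slices.

(** * Ehrling's inequality *)

Section ehrling.
Context {R : realType} {X Y : normedModType R} (i : {linear X -> Y}).
Variables (q : Y -> R) (C : R).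
Hypotheses (q_lip : forall y z, `|q y - q z| <= C * `|y - z|).
Hypothesis q0 : forall y, q y = 0 -> y = 0.
Hypothesis i_compact : forall B : set X, bounded_set B -> precompact (i @` B).

(** The points of norm at least e in the closure of the image of a ball form a compact set on which
    the continuous function q has no zero, so q stays away from 0 there. Applied with q the norm of
    V read on Y. *)
Lemma ehrling M e : 0 < e -> exists2 d, 0 < d &
  forall x, `|x| <= M -> `|q (i x)| < d -> `|i x| <= e.
Proof.
move=> e0; pose B := [set x : X | `|x| <= M].
have bB : bounded_set B.
  by exists M; split; [exact: num_real|move=> N MN x /= /le_trans; apply; exact: ltW].
have cK : compact (closure (i @` B)) by rewrite -precompactE; exact: i_compact.
pose F := [set y : Y | e <= `|y|].
have cF : closed F.
  apply: (@preimage_closed _ _ (fun y : Y => `|y|) [set r : R | e <= r]).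
    by move=> y _; exact: norm_continuous.
  exact: closed_ge.
have cKF : compact (closure (i @` B) `&` F) by exact: compact_closedI.
have cq : continuous q.
  move=> y; apply/cvgrPdist_le => eps eps0; near=> z.
  apply: (le_trans (q_lip _ _)); apply: (@le_trans _ _ ((`|C| + 1) * `|y - z|)).
    by rewrite ler_wpM2r// (le_trans (ler_norm _))// lerDl.
  rewrite mulrC -ler_pdivlMr ?ltr_wpDl//; near: z.
  by apply: cvgr_dist_le; [exact: cvg_id|rewrite divr_gt0// ltr_wpDl].
have cqKF : compact (q @` (closure (i @` B) `&` F)).
  by apply: continuous_compact => //; exact: continuous_subspaceT.
have oC : open (~` (q @` (closure (i @` B) `&` F))).
  by apply: closed_openC; apply: compact_closed => //; exact: Rhausdorff.
have n0 : (~` (q @` (closure (i @` B) `&` F))) 0.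
  move=> [y [_ Fy] /q0 y0]; move: Fy; rewrite /F/= y0 normr0 leNgt.
  by rewrite e0.
have /nbhs_ballP[d /= d0 dP] := open_nbhs_nbhs (conj oC n0).
exists d => // x xM qd; rewrite leNgt; apply/negP => ix.
apply: (dP (q (i x))); first by rewrite /ball/= sub0r normrN.
exists (i x) => //; split; last exact: ltW.
by apply: subset_closure; exists x.
Unshelve. all: by end_near. Qed.

End ehrling.

(** * Compactness in C0([0,T]; Y) *)

Section C0_compactness.
Context {R : realType}.
Local Notation mu := (@lebesgue_measure R).

(** Otherwise a null set would contain the interval from max(0, t - d) to min(T, t + d), which has
    positive length even when t is an endpoint. *)
Lemma full_measure_dense (T : R) (S : set R) : 0 < T ->
  {ae mu, forall t, `]0, T[%classic t -> S t} ->
  forall t d, 0 <= t <= T -> 0 < d -> exists2 s, S s & `|t - s| < d.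
Proof.
move=> T0 [A [mA A0 SA]] t d /andP[t0 tT] d0; apply: contrapT => nS.
pose a := Num.max 0 (t - d); pose b := Num.min T (t + d).
have ab : a < b by rewrite /a /b gt_max !lt_min T0; apply/and3P; split; lra.
have abA : `]a, b[%classic `<=` A.
  move=> s /=; rewrite in_itv/= /a /b gt_max lt_min => /andP[/andP[s0 ts] /andP[sT st]].
  apply: SA => /= Ss; apply: nS; exists s; last by rewrite ltr_distlC; apply/andP; split; lra.
  by apply: Ss; rewrite /= in_itv/= s0.
have : (mu `]a, b[%classic <= mu A)%E by rewrite le_measure ?inE.
rewrite A0 lebesgue_measure_itv/= lte_fin ab -EFinB lee_fin; lra.
Qed.

Variable T : R.
Local Notation K := (`[0, T]%classic : set R).

Lemma compact_itv_type : compact [set: K].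
Proof.
move=> F PF _.
have FK : (\val @ F) `[0, T]%classic.
  by apply: (@filterS _ F _ setT) => [u _|]; [exact: set_valP|exact: filterT].
have [t [Kt Ft]] := @segment_compact R 0 T (\val @ F) _ FK.
exists (SigSub (mem_set Kt)); split => // A B FA [_ [[C oC <-] Ct CB]].
have [||_ [[u Au <-] Cu]] := Ft (\val @` A) C.
- by apply: (@filterS _ F _ A) => // u Au; exists u.
- exact: open_nbhs_nbhs.
by exists u; split => //; exact: CB.
Qed.

Lemma near_itv_type (u : K) (d : R) : 0 < d -> \forall v \near u, `|\val u - \val v| < d.
Proof.
move=> d0; have := @initial_continuous _ _ (\val : K -> R) u.
move=> /(_ (ball (\val u) d)); apply.
exact: nbhsx_ballx.
Qed.

Variable Y : completeNormedModType R.

(** The value at u is the limit of F along S at u, which exists because Y is complete and F is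
    uniformly continuous on the dense set S. *)
Lemma continuous_extension (S : set R) (F : R -> Y) :
  (forall t d : R, 0 <= t <= T -> 0 < d -> exists2 s, S s & `|t - s| < d) ->
  (forall e : R, 0 < e -> exists2 d : R, 0 < d & forall s s', S s -> S s' ->
     `|s - s'| < d -> `|F s - F s'| <= e) ->
  exists g : continuousType K Y, forall u : K, S (\val u) -> g u = F (\val u).
Proof.
move=> dS uF.
pose Ft (t : R) := F @ within S (nbhs t).
have Kt (u : K) : 0 <= \val u <= T by have := set_valP u; rewrite /= in_itv.
have Fproper (u : K) : ProperFilter (Ft (\val u)).
  apply: fmap_proper_filter; apply: Build_ProperFilter_ex => A /nbhs_ballP[d /= d0 dA].
  by have [s Ss sd] := dS _ _ (Kt u) d0; exists s; apply: dA.
have Fcvg (u : K) : exists y : Y, Ft (\val u) --> y.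
  suff /cauchy_cvg FC : cauchy (Ft (\val u)) by exists (lim (Ft (\val u))).
  apply: cauchy_exP => e e0.
  have [d d0 dF] := uF (e / 2) (divr_gt0 e0 (ltr0Sn _ 1)).
  have d20 : 0 < d / 2 by rewrite divr_gt0.
  have [s0 Ss0 s0d] := dS _ _ (Kt u) d20.
  exists (F s0); suff : \forall s \near \val u, S s -> ball (F s0) e (F s) by [].
  have : \forall s \near \val u, `|\val u - s| < d / 2.
    exact: nbhsx_ballx.
  apply: filterS => s us Ss.
  rewrite -ball_normE /= (le_lt_trans (dF s0 s Ss0 Ss _))//; last by lra.
  rewrite (le_lt_trans (ler_distD (\val u) _ _))// (splitr d) ltrD//.
  by rewrite distrC.
have [G FG] := boolp.choice Fcvg.
(* Comparing G with F on S gives both the continuity of G, through a nearby point of S, and G = F on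
   S. *)
have GF e : 0 < e -> exists2 d, 0 < d & forall (u : K) s, S s ->
    `|\val u - s| < d -> `|G u - F s| <= e.
  move=> e0; have [d d0 dF] := uF e e0; exists d => // u s Ss us.
  apply/ler_addgt0Pr => eta eta0.
  have /cvgrPdist_le/(_ eta eta0) near1 := FG u.
  have near2 : \forall s' \near within S (nbhs (\val u)), S s' /\ `|s - s'| < d.
    rewrite near_withinE.
    have : \forall s' \near \val u, `|\val u - s'| < d - `|\val u - s|.
      by apply: nbhsx_ballx; rewrite subr_gt0.
    apply: filterS => s' us' Ss'; split => //.
    by rewrite (le_lt_trans (ler_distD (\val u) _ _))// -ltrBrDl [in ltRHS]distrC.
  have PFu := Fproper u.
  have [s' [[Ss' ss'] Gs']] : exists s', (S s' /\ `|s - s'| < d) /\ `|G u - F s'| <= eta.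
    have PW : ProperFilter (within S (nbhs (\val u))).
      apply: Build_ProperFilter_ex => A /nbhs_ballP[d' /= d'0 dA].
      by have [s1 Ss1 sd1] := dS _ _ (Kt u) d'0; exists s1; apply: dA.
    by apply: (@filter_ex _ (within S (nbhs (\val u)))); exact: filterI.
  rewrite (le_trans (ler_distD (F s') _ _))// addrC lerD// distrC.
  exact: dF.
have cG : continuous G.
  move=> u; apply/(@cvgrPdist_le _ _ _ (nbhs u) (nbhs_filter u)) => e e0.
  have [d d0 dG] := GF (e / 2) (divr_gt0 e0 (ltr0Sn _ 1)).
  have d20 : 0 < d / 2 by rewrite divr_gt0.
  have [s Ss us] := dS _ _ (Kt u) d20.
  have := near_itv_type u d20; apply: filterS => v uv.
  rewrite (le_trans (ler_distD (F s) _ _))// (splitr e) lerD//.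
    by apply: dG => //; lra.
  rewrite distrC; apply: dG => //.
  by rewrite (le_lt_trans (ler_distD (\val u) _ _))// (splitr d) ltrD// distrC.
exists (mkcts cG) => u Su; apply/eqP; rewrite -subr_eq0 -normr_le0.
apply/ler_addgt0Pr => e e0; rewrite add0r.
by have [d d0 dG] := GF e e0; apply: dG => //; rewrite subrr normr0.
Qed.

(** The Arzela-Ascoli theorem yields cluster points among all functions from K to Y. Since K is
    compact, convergence on compact sets is uniform, so these cluster points are continuous and are
    cluster points in [C0] as well. *)
Lemma C0_precompact (A : set (C0 T Y)) :
  precompact ([set ((g : continuousType K Y) : K -> Y) | g in A]
    : set {family compact, K -> Y}) -> precompact A.
Proof.
pose Phi (g : C0 T Y) : {family compact, K -> Y} := (g : continuousType K Y).
have cPhi : continuous Phi.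
  move=> g; have FF : Filter (Phi @ nbhs g) by apply: fmap_filter; exact: nbhs_filter.
  apply/fam_cvgP => B cB; apply: (@uniform_subset_cvg _ _ _ setT) => //.
  exact: (@initial_continuous _ _ _ g).
rewrite !precompactE => cA F PF FA.
have FPhi : (Phi @ F) (closure (Phi @` A)).
  apply: (@filterS _ F _ (closure A)) => // g clg.
  move=> U /cPhi/clg[a [Aa Ua]].
  by exists (Phi a); split => //; exists a.
have [h [clh Fh]] := cA (Phi @ F) _ FPhi.
have hc : continuous (h : K -> Y).
  move: clh; rewrite closureEcvg => -[G PG [Gh GA]].
  apply: (@uniform_limit_continuous _ _ G) => //.
    by apply: GA => _ [g _ <-]; exact: cts_fun.
  by move/fam_cvgP : Gh => /(_ setT compact_itv_type).
pose g : C0 T Y := mkcts hc : continuousType K Y.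
have nbhsg B : nbhs g B -> exists2 U, nbhs h U & forall g', U (Phi g') -> B g'.
  move=> [_ [[C oC <-] Cg CB]].
  have /uniform_nbhs[E [entE EC]] := open_nbhs_nbhs (conj oC Cg).
  exists [set h' | forall y, [set: K] y -> E (h y, h' y)].
    by apply: fam_nbhs => //; exact: compact_itv_type.
  by move=> g' Eg'; apply: CB; exact: EC.
exists g; split.
  move=> B /nbhsg[U hU UB]; have [_ [[a Aa <-] Ua]] := clh U hU.
  by exists a; split => //; exact: UB.
move=> B C FB /nbhsg[U hU UC].
have [||_ [[b Bb <-] Ub]] := Fh (Phi @` B) U => //.
  by apply: (@filterS _ F _ B) => // b Bb; exists b.
by exists b; split => //; exact: UC.
Qed.

Lemma C0_ascoli (A : set (C0 T Y)) (Kc : set Y) : compact Kc ->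
  (forall (g : C0 T Y) u, A g -> Kc ((g : continuousType K Y) u)) ->
  (forall e : R, 0 < e -> exists2 d : R, 0 < d & forall (g : C0 T Y) (u v : K),
     A g -> `|\val u - \val v| < d ->
     `|(g : continuousType K Y) u - (g : continuousType K Y) v| <= e) ->
  precompact A.
Proof.
move=> cKc AK equi; apply: C0_precompact.
apply: pointwise_precompact_equicontinuous.
- exact: norm_hausdorff.
- move=> u; exists Kc.
    by move=> _ [_ [g Ag <-] <-]; exact: AK.
  split => //; apply: compact_closed => //; exact: norm_hausdorff.
- move=> u E; rewrite -entourage_ballE => -[e /= e0 eE].
  have [d d0 dP] := equi (e / 2) (divr_gt0 e0 (ltr0Sn _ 1)).
  have := near_itv_type u d0; apply: filterS => v uv _ [g Ag <-].
  apply: eE; rewrite /= -ball_normE /= (le_lt_trans (dP g u v Ag uv))//.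
  lra.
Qed.

End C0_compactness.

(** * Continuous representatives and approximation from dense sets *)

Section representatives.
Context {R : realType} {Y : completeNormedModType R}.
Variable T : R.
Local Notation K := (`[0, T]%classic : set R).
Local Notation mu := (@lebesgue_measure R).

(** Representatives are compared with f on [0,T], estimates on f hold inside (0,T); the two
    endpoints form a null set. *)
Lemma ae_itv_interior (P : R -> Prop) :
  {ae mu, forall t, `]0, T[%classic t -> P t} ->
  {ae mu, forall t, `[0, T]%classic t -> `]0, T[%classic t /\ P t}.
Proof.
have aeF : Filter (almost_everywhere mu) by exact: ae_filter_ringOfSetsType.
have n1 a : {ae mu, forall t : R, t != a}.
  exists [set a]; split; [exact: measurable_set1|exact: lebesgue_measure_set1|].
  by move=> t /= /negP; rewrite negbK => /eqP.
move: (n1 0) (n1 T); apply: filterS3 => t t0 tT tP.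
rewrite /= !in_itv/= => /andP[t0' tT'].
have tI : 0 < t < T by rewrite !lt_neqAle t0' tT' eq_sym t0 tT.
by split => //; apply: tP; rewrite /= in_itv.
Qed.

(** A representative is tied to f on a dense set only; bounds reach its other values through such
    approximations. *)
Lemma C0_dense_approx (g : C0 T Y) (S : set R) (F : R -> Y) :
  (forall t d : R, 0 <= t <= T -> 0 < d -> exists2 s, S s & `|t - s| < d) ->
  S `<=` `[0, T]%classic ->
  (forall u : K, S (\val u) -> (g : continuousType K Y) u = F (\val u)) ->
  forall (u : K) (e d : R), 0 < e -> 0 < d ->
    exists s, [/\ S s, `|\val u - s| < d & `|(g : continuousType K Y) u - F s| <= e].
Proof.
move=> dS SK gF u e d e0 d0.
have u0T : 0 <= \val u <= T by have := set_valP u; rewrite /= in_itv.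
have /(@cvgrPdist_le _ _ _ (nbhs u) (nbhs_filter u))/(_ e e0) :=
  @cts_fun _ _ (g : continuousType K Y) u.
move=> [_ [[C oC <-] /= Cu Cg]].
have /nbhs_ballP[d' /= d'0 dC] := open_nbhs_nbhs (conj oC Cu).
have dd0 : 0 < Num.min d d' by rewrite lt_min d0.
have [s Ss] := dS _ _ u0T dd0; rewrite lt_min => /andP[sd sd'].
exists s; split => //; pose us : K := SigSub (mem_set (SK s Ss)).
have -> : F s = (g : continuousType K Y) us by rewrite gF.
by apply: Cg; apply: dC.
Qed.

End representatives.

(** * Relative compactness of L in C0([0,T]; Y) *)

Theorem theorem6p2 (R : realType) (N : nat) (Omega : set 'rV[R]_N)
    (phi alpha : 'rV[R]_N -> R -> R) (T : R)
    (X Y : completeNormedModType R) (i : {linear X -> Y})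
    (j : Y -> 'rV[R]_N -> R) (L : set (R -> X)) :
  let V := Lphi (lebesgue_rV N) Omega phi in
  let normV := luxemburg (lebesgue_rV N) Omega phi in
  let Q := Omega `*` (`]0, T[ : set R) in
  let muQ := (lebesgue_rV N \x @lebesgue_measure R)%E in
  let phiQ := fun (z : 'rV[R]_N * R) r => phi z.1 r in
  (0 < N)%N -> open Omega -> (lebesgue_rV N Omega < +oo)%E -> 0 < T ->
  assumptionA Omega phi alpha ->
  compact_embedding i ->
  embedding_in_Lphi (lebesgue_rV N) Omega phi j ->
  L `<=` Linfty T ->
  (exists M : R, forall f, L f -> (Linfty_norm T f <= M%:E)%E) ->
  (exists M : R, forall f, L f ->
    exists v : 'rV[R]_N * R -> R,
      [/\ Lphi muQ Q phiQ v, (luxemburg muQ Q phiQ v <= M%:E)%E &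
          is_time_derivative T V normV
            (fun t => j (i (f t))) (fun t x => v (x, t))]) ->
  (forall f, L f -> exists g : C0 T Y, C0_representative i f g) /\
  precompact [set g : C0 T Y |
    (exists2 f, L f & C0_representative i f g)].
Proof.
move=> V normV Q muQ phiQ _ oO _ T0 A [_ ci compi] [jV jlin jinj [C0 jC0]] LX [M LM] [M' LM'].
have [K mus] := assumptionA_musielak oO A.
have sl : sublinear V normV := luxemburg_sublinear mus.
have aeF : Filter (almost_everywhere (@lebesgue_measure R)).
  exact: ae_filter_ringOfSetsType.
have iB a b : i a - i b = i (a - b) by rewrite linearB.
pose C := `|C0|; have Cge0 : 0 <= C by exact: normr_ge0.
have jC y : (normV (j y) <= (C * `|y|)%:E)%E.
  by rewrite (le_trans (jC0 y))// lee_fin ler_wpM2r// ler_norm.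
have jB y z : normV (j y - j z) = normV (j (y - z)).
  apply: (eq_luxemburg mus); apply: filterS (jlin (-1) z y) => x jx Ox.
  have := jx Ox; rewrite scaleN1r addrC => ->.
  by rewrite -[RHS]/(-1 * j z x + j y x) -[LHS]/(j y x - j z x) mulN1r addrC.
have [Ci Ci0 iC] : exists2 Ci, 0 <= Ci & forall x, `|i x| <= Ci * `|x|.
  have /linear_boundedP[r [_ rP]] := continuous_linear_bounded 0 (ci 0).
  exists (`|r| + 1); first by rewrite addr_ge0.
  by apply: rP; rewrite (le_lt_trans (ler_norm _))// ltrDl.
pose q y := fine (normV (j y)).
have jfin y : normV (j y) \is a fin_num.
  by rewrite ge0_fin_numE ?(subl_ge0 sl)// (subl_fin sl (jV y)).
have qle y z : q y <= q z + C * `|y - z|.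
  rewrite -lee_fin EFinD !fineK//.
  have := subl_le_dist sl (jV z) (jV y) => /le_trans; apply.
  by rewrite [leLHS]addeC leeD2l// jB distrC jC.
have q_lip y z : `|q y - q z| <= C * `|y - z|.
  rewrite ler_norml; have := qle z y; have := qle y z; rewrite [`|z - y|]distrC.
  by move=> ? ?; apply/andP; split; lra.
have q0 y : q y = 0 -> y = 0.
  move=> qy; apply: jinj; apply: (luxemburg_eq0 mus); first by case: (jV y).
  by rewrite -[LHS](fineK (jfin y)) -/(q y) qy.
have K0 : 0 < K by rewrite (lt_le_trans _ (musielak_K mus)).
(* Adding 1 gives the strict inequality required by [slices_luxemburg]. *)
pose l := `|M'| + 1.
have l0 : 0 < l by rewrite ltr_wpDl.
pose al n := l * (2 / K) ^- n.
pose be n := l / 2 ^+ n.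
have al0 n : 0 <= al n.
  by rewrite mulr_ge0 ?(ltW l0)// invr_ge0 exprn_ge0// divr_ge0// ltW.
have be0 n : 0 <= be n by rewrite divr_ge0 ?(ltW l0)// exprn_ge0.
pose good (f : R -> X) (S : set R) := [/\ S `<=` `]0, T[%classic,
  {ae @lebesgue_measure R, forall t, `]0, T[%classic t -> S t},
  forall t, S t -> `|f t| <= M &
  forall s t n, S s -> S t -> s < t ->
    (normV (j (i (f t)) - j (i (f s)))%R <= (al n * (t - s) + be n)%:E)%E].
have Lgood f : L f -> exists S, good f S.
  move=> Lf; have [fsm _] := LX f Lf; have [v [Vv vM' td]] := LM' f Lf.
  have fM : {ae @lebesgue_measure R, forall t, `]0, T[%classic t -> `|f t| <= M}.
    have /ess_supP := LM f Lf; apply: filterS => t + Dt.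
    by rewrite patchE mem_set// lee_fin.
  have vl : (luxemburg muQ Q phiQ v < l%:E)%E.
    by rewrite (le_lt_trans vM')// lte_fin (le_lt_trans (ler_norm _))// ltrDl.
  have mD : measurable (`]0, T[%classic : set (measurableTypeR R)) by [].
  have [h [mh h0 h1 wh]] := slices_luxemburg mD mus Vv vl.
  have uf s t : (normV (j (i (f t)) - j (i (f s)))%R <= (C * Ci * `|f t - f s|)%:E)%E.
    rewrite jB (le_trans (jC _))// lee_fin -mulrA ler_wpM2l// iB.
    exact: iC.
  have CCi0 : 0 <= C * Ci by rewrite mulr_ge0.
  have [S [SD SF Sle]] := weak_derivative_modulus sl CCi0 al0 be0 fsm fM
    (fun t => jV (i (f t))) uf mh h0 h1 wh td.
  exists [set t | S t /\ `|f t| <= M]; split.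
  - by move=> t [/SD].
  - by apply: filterS2 SF fM => t St fMt Dt; split; [exact: St|exact: fMt].
  - by move=> t [].
  - by move=> s t n [Ss _] [St _]; exact: Sle.
have equi e : 0 < e -> exists2 d, 0 < d & forall f S s t, good f S -> S s -> S t ->
    `|s - t| < d -> `|i (f s) - i (f t)| <= e.
  (* Differences of values of f have norm at most |M| + |M| in X. n is fixed by [be n < d / 2],
     which holds once 2^n > 2l/d; then |s - t| < d / (2 (al n + 1)) makes the remaining term less
     than d / 2. *)
  move=> e0; have [d d0 dP] := ehrling q_lip q0 compi (`|M| + `|M|) e0.
  have [n nd] : exists n, be n < d / 2.
    exists (Num.bound (2 * l / d)); rewrite /be ltr_pdivrMr ?exprn_gt0//.
    have := upper_nthrootP (leqnn (Num.bound (2 * l / d))).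
    by rewrite ltr_pdivrMr// => ?; lra.
  exists (d / (2 * (al n + 1))).
    by rewrite divr_gt0// mulr_gt0// ltr_wpDl.
  move=> f S; suff H s t : good f S -> S s -> S t -> s < t ->
      `|s - t| < d / (2 * (al n + 1)) -> `|i (f s) - i (f t)| <= e.
    move=> s t gS Ss St std; have [st|ts|->] := ltgtP s t; first exact: H.
      by rewrite distrC H// distrC.
    by rewrite subrr normr0 ltW.
  move=> [_ _ fM Sle] Ss St st std.
  rewrite -normrN opprB iB; apply: dP.
    by rewrite (le_trans (ler_normB _ _))// lerD// (le_trans (fM _ _))// ler_norm.
  rewrite ger0_norm ?fine_ge0 ?(subl_ge0 sl)// -lte_fin fineK// -iB -jB.
  rewrite (le_lt_trans (Sle s t n Ss St st))// lte_fin.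
  move: std; rewrite ltr0_norm ?subr_lt0// opprB ltr_pdivlMr ?mulr_gt0 ?ltr_wpDl//.
  have := al0 n; nra.
(* The closure is taken because the values of a representative are only limits of values i (f s)
   with |f s| <= M. *)
pose bigK := closure (i @` [set x : X | `|x| <= M]).
split.
- move=> f /Lgood[S gS]; have [SD SF _ _] := gS.
  have dS := full_measure_dense T0 SF.
  have uF e : 0 < e -> exists2 d, 0 < d & forall s t, S s -> S t ->
      `|s - t| < d -> `|(i \o f) s - (i \o f) t| <= e.
    by move=> /equi[d d0 dP]; exists d => // s t; exact: dP gS.
  have [g gP] := continuous_extension dS uF.
  exists g; apply: filterS (ae_itv_interior SF) => t tS u ut.
  have [_ St] : `]0, T[%classic t /\ S t by apply: tS; rewrite -ut; exact: set_valP.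
  by rewrite -ut; apply: gP; rewrite ut.
(* Precompactness concerns every representative, not just those constructed above, so the estimates
   on S are passed to an arbitrary g through the points of S where g agrees with i o f. *)
have approx g f : L f -> C0_representative i f g -> exists2 S, good f S &
    forall (u : (`[0, T]%classic : set R)) (e d : R), 0 < e -> 0 < d ->
    exists s, [/\ S s, `|\val u - s| < d &
      `|(g : continuousType (`[0, T]%classic : set R) Y) u - i (f s)| <= e].
  move=> Lf gf; have [S gS] := Lgood f Lf; exists S => //.
  have [SD SF _ _] := gS.
  pose S' := [set t | S t /\ forall u : (`[0, T]%classic : set R), \val u = t ->
    (g : continuousType _ _) u = i (f t)].
  have S'F : {ae @lebesgue_measure R, forall t, `]0, T[%classic t -> S' t}.
    by apply: filterS2 SF gf => t St gt Dt; split => //; exact: St.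
  have S'K : S' `<=` `[0, T]%classic by move=> t [/SD + _]; exact: subset_itv_oo_cc.
  move=> u e d e0 d0.
  have [s [[Ss _] us gs]] := C0_dense_approx (F := i \o f) (full_measure_dense T0 S'F) S'K
    (fun u Su => Su.2 u erefl) u e0 d0.
  by exists s.
apply: (@C0_ascoli _ _ _ _ bigK).
- rewrite -precompactE; apply: compi; exists M; split; first exact: num_real.
  by move=> r Mr x /= /le_trans; apply; exact: ltW.
- move=> g u [f Lf gf]; have [S [_ _ fM _] Sg] := approx g f Lf gf.
  move=> B /nbhs_ballP[e /= e0 eB].
  have [s [Ss _ gs]] := Sg u (e / 2) 1 (divr_gt0 e0 (ltr0Sn _ 1)) ltr01.
  exists (i (f s)); split; first by exists (f s) => //; exact: fM.
  by apply: eB; rewrite -ball_normE /= (le_lt_trans gs)//; lra.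
- move=> e e0; have e30 : 0 < e / 3 by rewrite divr_gt0.
  have [d d0 dP] := equi (e / 3) e30.
  exists (d / 2); first by rewrite divr_gt0.
  move=> g u v [f Lf gf] uv; have [S gS Sg] := approx g f Lf gf.
  have d40 : 0 < d / 4 by rewrite divr_gt0.
  have [s [Ss us gs]] := Sg u _ _ e30 d40.
  have [t [St vt gt]] := Sg v _ _ e30 d40.
  (* d/4 + d/2 + d/4, through u and v; the norms in Y are then summed as three times e/3. *)
  have st : `|s - t| < d.
    have := ler_distD (\val u) s t; have := ler_distD (\val v) (\val u) t.
    rewrite [`|s - \val u|]distrC; lra.
  have := dP f S s t gS Ss St st.
  have := ler_distD (i (f s)) ((g : continuousType _ _) u) ((g : continuousType _ _) v).
  have := ler_distD (i (f t)) (i (f s)) ((g : continuousType _ _) v).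
  rewrite [X in _ <= _ + X]distrC; lra.
Qed.
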